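(* Let $\mathfrak{A},\mathfrak{B}$ be unital $C^*$-algebras, let $N\in\mathfrak{A}$ be a normal element whose spectrum $\sigma(N)$ is a Lavrentieff set, and let $A\in\mathfrak{B}$. Suppose $\|p(N)\|=\|p(A)\|$ for every complex polynomial $p$ (norms being the $C^*$-norms of $\mathfrak{A}$ and $\mathfrak{B}$ respectively). Then $A$ is normal.
   Context: A compact set $K\subseteq\mathbb{C}$ is a Lavrentieff set if $\mathbb{C}\setminus K$ is connected and $K$ has empty interior. *)

(* Defs.v *)
From HB Require Import structures.
From mathcomp Require Import all_boot all_order all_algebra.
From mathcomp Require Import complex.
From mathcomp Require Import all_classical all_reals all_analysis.
Set Implicit Arguments. Unset Strict Implicit. Unset Printing Implicit Defensive.
Import Order.TTheory GRing.Theory Num.Theory ComplexField.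
Import numFieldNormedType.Exports.
Local Open Scope classical_set_scope.
Local Open Scope ring_scope.

(* The complex field C = R[i], packaged as a numClosedFieldType so that it
   receives its standard (modulus-induced) topology from MathComp-Analysis. *)
Definition cplx (R : realType) : numClosedFieldType := R[i].

Definition is_unital_Cstar_algebra (R : realType) (A : algType (cplx R))
    (star : A -> A) (nrm : A -> R) : Prop :=
  [/\
      [/\ (forall x, 0 <= nrm x),
      (forall x, nrm x = 0 -> x = 0),
      (forall x y, nrm (x + y) <= nrm x + nrm y),
      (forall (c : cplx R) x, ((nrm (c *: x))%:C)%C = `|c| * ((nrm x)%:C)%C) &
      (forall x y, nrm (x * y) <= nrm x * nrm y)],
      (forall u : nat -> A,
         (forall e : R, 0 < e -> exists M : nat, forall m n : nat,
              (M <= m)%N -> (M <= n)%N -> nrm (u m - u n) < e) ->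
         exists l : A, forall e : R, 0 < e -> exists M : nat, forall n : nat,
              (M <= n)%N -> nrm (u n - l) < e) &
      [/\ (forall x y, star (x + y) = star x + star y),
          (forall (c : cplx R) x, star (c *: x) = c^* *: star x),
          (forall x y, star (x * y) = star y * star x),
          (forall x, star (star x) = x) &
          (forall x, nrm (star x * x) = nrm x ^+ 2)]].

Definition normal_elt (R : realType) (A : algType (cplx R)) (star : A -> A) (x : A)
  : Prop := star x * x = x * star x.

Definition invertible (R : realType) (A : algType (cplx R)) (x : A) : Prop :=
  exists y : A, x * y = 1 /\ y * x = 1.

Definition spectrum (R : realType) (A : algType (cplx R)) (x : A) : set (cplx R) :=
  [set z : cplx R | ~ invertible (x - z%:A)].

Definition Lavrentieff (R : realType) (K : set (cplx R)) : Prop :=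
  [/\ compact K, connected (~` K) & interior K = set0].

(* Main.v *)
(* Lavrentieff's theorem gives polynomials q_n tending to conj uniformly on K = sigma(N), so
   q_n(N) -> N^*, because a norm in a commutative C*-algebra is attained by a multiplicative
   C*-seminorm, i.e. at a point of the spectrum.  By the isometry q_n(A) tends to some L, and
   |x + it|^2 <= |y|^2 + t^2 for every self-adjoint y = c N + d N^* and x = c A + d L; this
   growth forces x to be self-adjoint, hence L = A^*, and L commutes with A.

   Lavrentieff's theorem for conj is proved without measures or conformal maps.  The sum of
   1 / (z - w) over the nodes w of a large square lattice increases by almost the same constant c
   when z moves by 1, and by -ic when z moves by i, so it is c conj(z) up to an error that is
   small compared with 1 / mesh.  Near each node the Cauchy kernel is replaced, as in Mergelyan's
   theorem, by a bounded uniform limit of polynomials, which is built from a branch of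
   sqrt((z - a) (z - b)) with a and b in the complement of K at a distance comparable to the
   mesh; the branch exists because the complement is connected and dense. *)
Require Import Defs.
From HB Require Import structures.
From mathcomp Require Import all_boot all_order all_algebra.
From mathcomp Require Import complex finmap.
From mathcomp Require Import all_classical all_reals all_analysis.
From mathcomp Require Import ring lra zify.
Set Implicit Arguments. Unset Strict Implicit. Unset Printing Implicit Defensive.
Import Order.TTheory GRing.Theory Num.Theory ComplexField.
Import numFieldNormedType.Exports.
Local Open Scope classical_set_scope.
Local Open Scope ring_scope.

(** The order of contact between the Cauchy kernel and its substitute decides the approximation. An
    error of inverse square order in the distance, measured in mesh units, has a sum over a planar
    lattice that grows only logarithmically (the cruder square root of the side suffices), whereas a
    first-order error could swamp the main term. In mesh units [K] lies in a disc of radius [M] and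
    the lattice has half side [n]; the errors are of order [sqrt n] and [M ^ 2 / n] against a main
    term of order [M], which asks for [sqrt n << M << n].

    On the algebraic side, real-valued C*-seminorms on a commutative algebra around [N] take the
    place of characters and quotients. Their axioms are inequalities that survive infima, so Zorn's
    lemma yields a minimal one directly. The corresponding point of the spectrum is then extracted
    by Ostrowski's argument on polynomials, in the role that Liouville's theorem for the resolvent
    usually plays. *)

Definition md (R : realType) (z : cplx R) : R := complex.Re `|z|.

(** * The complex modulus as an element of [R] *)

Section Modulus.
Variable R : realType.
Local Notation C := (cplx R).
Implicit Types z w : C.

Lemma mdE z : ((md z)%:C)%C = `|z|.
Proof. by rewrite /md normc_def. Qed.

Lemma md_sqr z : md z ^+ 2 = complex.Re z ^+ 2 + complex.Im z ^+ 2.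
Proof. by rewrite /md normc_def /= sqr_sqrtr // addr_ge0 ?sqr_ge0. Qed.

Lemma md_ge0 z : 0 <= md z.
Proof. by rewrite /md normc_def /= sqrtr_ge0. Qed.

Lemma md0 : md 0 = 0 :> R.
Proof. by rewrite /md normr0. Qed.

Lemma md1 : md 1 = 1 :> R.
Proof. by rewrite /md normr1. Qed.

Lemma mdN z : md (- z) = md z.
Proof. by rewrite /md normrN. Qed.

Lemma mdB z w : md (z - w) = md (w - z).
Proof. by rewrite /md distrC. Qed.

Lemma mdM z w : md (z * w) = md z * md w.
Proof. by apply: (@complexI R); rewrite rmorphM /= !mdE normrM. Qed.

Lemma mdX z n : md (z ^+ n) = md z ^+ n.
Proof. by elim: n => [|n IH]; rewrite ?expr0 ?md1 // !exprS mdM IH. Qed.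

Lemma mdV z : md z^-1 = (md z)^-1.
Proof. by apply: (@complexI R); rewrite fmorphV /= !mdE normfV. Qed.

Lemma md_div z w : md (z / w) = md z / md w.
Proof. by rewrite mdM mdV. Qed.

Lemma mdD z w : md (z + w) <= md z + md w.
Proof. by rewrite -lecR rmorphD /= !mdE ler_normD. Qed.

Lemma md_triangle u z w : md (z - w) <= md (z - u) + md (u - w).
Proof. by apply: le_trans (mdD _ _); rewrite addrA subrK. Qed.

Lemma md_ge_sub z w : md z - md w <= md (z - w).
Proof. by rewrite lerBlDr -{1}(subrK w z) mdD. Qed.

Lemma md_ge_add z w : md z - md w <= md (z + w).
Proof. by rewrite -(mdN w) -{2}(opprK w); apply: md_ge_sub. Qed.

Lemma md_eq0 z : (md z == 0) = (z == 0).
Proof. by rewrite -(inj_eq (@complexI R)) mdE normr_eq0. Qed.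

Lemma md_gt0 z : (0 < md z) = (z != 0).
Proof. by rewrite lt_neqAle md_ge0 andbT eq_sym md_eq0. Qed.

Lemma md_real (x : R) : md (x%:C)%C = `|x|.
Proof. by rewrite /md normc_def /= expr0n addr0 sqrtr_sqr. Qed.

Lemma md_nat n : md n%:R = n%:R :> R.
Proof. by rewrite /md normr_nat -(rmorph_nat (real_complex R)). Qed.

Lemma md_i : md 'i = 1 :> R.
Proof. by rewrite /md normCi. Qed.

Lemma mdJ z : md z^* = md z.
Proof. by rewrite /md norm_conjC. Qed.

Lemma Re_le_md z : `|complex.Re z| <= md z.
Proof.
by rewrite -(@ler_pXn2r _ 2) ?nnegrE ?md_ge0 // md_sqr real_normK ?num_real // lerDl sqr_ge0.
Qed.

Lemma Im_le_md z : `|complex.Im z| <= md z.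
Proof.
by rewrite -(@ler_pXn2r _ 2) ?nnegrE ?md_ge0 // md_sqr real_normK ?num_real // lerDr sqr_ge0.
Qed.

Lemma md_le_ReIm z : md z <= `|complex.Re z| + `|complex.Im z|.
Proof.
rewrite -(@ler_pXn2r _ 2) ?nnegrE ?md_ge0 ?addr_ge0 // md_sqr.
rewrite -(real_normK (num_real (complex.Re z))) -(real_normK (num_real (complex.Im z))).
have := normr_ge0 (complex.Re z); have := normr_ge0 (complex.Im z); nra.
Qed.

Lemma md_sum (I : Type) (s : seq I) (F : I -> C) :
  md (\sum_(i <- s) F i) <= \sum_(i <- s) md (F i).
Proof.
elim: s => [|i s IH]; first by rewrite !big_nil md0.
by rewrite !big_cons; apply: le_trans (mdD _ _) _; rewrite lerD2l.
Qed.

Lemma ReD z w : complex.Re (z + w) = complex.Re z + complex.Re w.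
Proof. by case: z; case: w. Qed.

Lemma ImD z w : complex.Im (z + w) = complex.Im z + complex.Im w.
Proof. by case: z; case: w. Qed.

Lemma ReN z : complex.Re (- z) = - complex.Re z.
Proof. by case: z. Qed.

Lemma ImN z : complex.Im (- z) = - complex.Im z.
Proof. by case: z. Qed.

Lemma Re_nat n : complex.Re (n%:R : C) = n%:R.
Proof. by rewrite -(rmorph_nat (real_complex R)). Qed.

Lemma Im_nat n : complex.Im (n%:R : C) = 0.
Proof. by rewrite -(rmorph_nat (real_complex R)). Qed.

Lemma cplx_eq z w : complex.Re z = complex.Re w -> complex.Im z = complex.Im w -> z = w.
Proof. by case: z w => [a b] [c d] /= -> ->. Qed.

Lemma iE : 'i = Complex 0 1 :> C.
Proof. by rewrite -complexiE. Qed.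

Lemma conjE z : z^* = Complex (complex.Re z) (- complex.Im z).
Proof.
apply: cplx_eq => /=; apply: (@complexI R).
  by rewrite !complexRe Re_conj.
by rewrite rmorphN /= !complexIm Im_conj.
Qed.

Lemma ReiM z : complex.Re ('i * z) = - complex.Im z.
Proof. by rewrite iE; case: z => a b /=; rewrite mul0r mul1r sub0r. Qed.

Lemma ImiM z : complex.Im ('i * z) = complex.Re z.
Proof. by rewrite iE; case: z => a b /=; rewrite mul0r mul1r add0r. Qed.

End Modulus.

(** * Lattice sums of the truncated Cauchy kernel *)

Section Lattice.
Variable R : realType.
Local Notation C := (cplx R).
Implicit Types (z w u : C) (n : nat).

(** The cutoff 10 matches the radius [10 * r] beyond which [disc_branch] controls the root; closer
    in, the polynomial substitute is merely bounded and is compared with 0. *)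
Definition kern w : C := if 10 <= md w then w^-1 else 0.

Lemma kernI w : kern ('i * w) = - 'i * kern w.
Proof.
rewrite /kern mdM md_i mul1r; case: ifP => _; last by rewrite mulr0.
by rewrite invfM invCi.
Qed.

Lemma kern_lip w u : md u <= 2 -> md (kern (w + u) - kern w) <= 300 / (1 + md w ^+ 2).
Proof.
move=> hu; have hw := md_ge0 w; have h1 := mdD w u.
have h2 : md w - md u <= md (w + u) by apply: md_ge_add.
have hp : 0 < 1 + md w ^+ 2 by nra.
have hinv (v : C) : 10 <= md v -> md v^-1 <= 10^-1.
  by move=> hv; rewrite mdV lef_pV2 ?posrE //; lra.
rewrite /kern; case: ifP => hA; case: ifP => hB.
- have nw : w != 0 by rewrite -md_gt0; lra.
  have nwu : w + u != 0 by rewrite -md_gt0; lra.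
  have -> : (w + u)^-1 - w^-1 = - u / ((w + u) * w) by field; rewrite nw nwu.
  rewrite md_div mdN mdM ler_pdivrMr; last by apply: mulr_gt0; lra.
  rewrite mulrAC ler_pdivlMr //.
  have h3 : (md w - 2) * md w <= md (w + u) * md w by apply: ler_pM; lra.
  have h4 : md u * (1 + md w ^+ 2) <= 2 * (1 + md w ^+ 2) by apply: ler_wpM2r; lra.
  by nra.
- rewrite subr0; apply: (le_trans (hinv _ hA)).
  have {}hB : md w < 10 by rewrite ltNge hB.
  by rewrite ler_pdivlMr //; nra.
- rewrite sub0r mdN; apply: (le_trans (hinv _ hB)).
  have {}hA : md (w + u) < 10 by rewrite ltNge hA.
  by rewrite ler_pdivlMr //; nra.
- by rewrite (subrr (0 : C)) (md0 R); apply: divr_ge0; [apply: ler0n | apply: ltW].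
Qed.

(* By induction on m, removing the end point of largest modulus, which is at least (m - 1) / 2. *)
Lemma sum_unit_spaced (phi : R -> R) (y : R) (m : nat) :
  (forall s t, 0 <= s -> s <= t -> phi t <= phi s) ->
  \sum_(0 <= i < m) phi `|y + i%:R| <= \sum_(0 <= i < m) phi (i%:R / 2).
Proof.
move=> hphi; elim: m y => [|m IH] y; first by rewrite !big_nil.
have hm : 0 <= m%:R :> R by [].
rewrite [leRHS]big_nat_recr //=.
have [hl|hl] := leP (m%:R / 2) `|y + m%:R|.
  by rewrite big_nat_recr //= lerD // hphi //; lra.
rewrite big_nat_recl // addrC lerD //; last first.
  by under eq_bigr do rewrite -nat1r addrA; apply: IH.
rewrite addr0; apply: hphi; first by lra.
by move: hl; rewrite ltr_norml => /andP[_ hl]; rewrite ler_normr; apply/orP; right; lra.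
Qed.

(** Passing from [m] to [m + 1] adds [2 m + 1] border terms, each at most [1 / (1 + m ^ 2 / 4)].
    Together they are at most [12 / (m + 1)], which the increment of [24 sqrt m] absorbs. *)
Lemma quarter_plane_sum (m : nat) :
  \sum_(0 <= k < m) \sum_(0 <= l < m) (1 + (k%:R / 2) ^+ 2 + (l%:R / 2) ^+ 2)^-1
    <= 24 * Num.sqrt m%:R :> R.
Proof.
elim: m => [|m IH]; first by rewrite big_nil mulr_ge0 // sqrtr_ge0.
rewrite big_nat_recr //=.
under eq_bigr do rewrite big_nat_recr //=.
rewrite big_split /= -addrA.
set q : R := (1 + (m%:R / 2) ^+ 2)^-1.
have q0 : 0 < 1 + (m%:R / 2) ^+ 2 :> R by have := sqr_ge0 (m%:R / 2 : R); lra.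
have hq k : (1 + (k%:R / 2) ^+ 2 + (m%:R / 2) ^+ 2)^-1 <= q.
  by rewrite /q lef_pV2 ?posrE //; have := sqr_ge0 (k%:R / 2 : R); lra.
have h1 : \sum_(0 <= k < m) (1 + (k%:R / 2) ^+ 2 + (m%:R / 2) ^+ 2)^-1 <= m%:R * q.
  apply: le_trans (_ : \sum_(0 <= k < m) q <= _); first exact: ler_sum.
  by rewrite sumr_const_nat subn0 mulr_natl.
have h2 : \sum_(0 <= l < m.+1) (1 + (m%:R / 2) ^+ 2 + (l%:R / 2) ^+ 2)^-1 <= m.+1%:R * q.
  apply: le_trans (_ : \sum_(0 <= k < m.+1) q <= _).
    by apply: ler_sum => k _; rewrite addrAC; apply: hq.
  by rewrite sumr_const_nat subn0 mulr_natl.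
have hs : 24 * Num.sqrt m%:R + (m%:R + m.+1%:R) * q <= 24 * Num.sqrt m.+1%:R.
  set a := Num.sqrt m%:R; set b := Num.sqrt (m.+1)%:R.
  have a0 : 0 <= a by apply: sqrtr_ge0.
  have b0 : 0 < b by rewrite sqrtr_gt0 ltr0Sn.
  have aa : a ^+ 2 = m%:R by rewrite sqr_sqrtr.
  have bb : b ^+ 2 = m%:R + 1 by rewrite sqr_sqrtr // -natr1.
  have ab : a <= b by rewrite ler_sqrt // ler_nat.
  have hm : (m%:R + m.+1%:R) * q <= 12 / b ^+ 2.
    rewrite bb /q ler_pdivrMr // mulrAC ler_pdivlMr; last by rewrite natr1 ltr0Sn.
    rewrite -natr1; have := sqr_ge0 (m%:R - 3/2 : R); lra.
  have : 12 / b ^+ 2 <= 24 * (b - a); last by lra.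
  rewrite ler_pdivrMr ?exprn_gt0 //.
  have h3 : (b - a) * (b + a) = 1 by nra.
  have h4 : (b - a) * (b + a) <= (b - a) * (2 * b) by apply: ler_wpM2l; lra.
  have h5 : 1 <= b ^+ 2 by rewrite bb lerDr.
  have h6 : 1 <= b by nra.
  by nra.
by apply: le_trans hs; lra.
Qed.

Definition node n i j : C := (i%:R - n%:R) + 'i * (j%:R - n%:R).

Lemma Re_node n i j : complex.Re (node n i j) = i%:R - n%:R.
Proof. by rewrite !(ReD, ReN, ReiM, ImD, ImN, Re_nat, Im_nat) subr0 oppr0 addr0. Qed.

Lemma Im_node n i j : complex.Im (node n i j) = j%:R - n%:R.
Proof. by rewrite !(ReD, ReN, ImiM, ImD, ImN, Re_nat, Im_nat) subr0 add0r. Qed.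

Lemma node_sum n z :
  \sum_(0 <= i < (2 * n).+1) \sum_(0 <= j < (2 * n).+1) (1 + md (z - node n i j) ^+ 2)^-1
    <= 24 * Num.sqrt (2 * n).+1%:R.
Proof.
apply: le_trans (quarter_plane_sum _).
set x := - n%:R - complex.Re z; set y := - n%:R - complex.Im z.
have E i j : 1 + md (z - node n i j) ^+ 2 = 1 + `|x + i%:R| ^+ 2 + `|y + j%:R| ^+ 2.
  rewrite md_sqr ReD ImD ReN ImN Re_node Im_node !real_normK ?num_real // /x /y.
  by ring.
have hdec (a : R) : 0 <= a -> forall s t, 0 <= s -> s <= t -> (1 + a + t ^+ 2)^-1 <= (1 + a + s ^+ 2)^-1.
  by move=> a0 s t s0 st; rewrite lef_pV2 ?posrE //; nra.
apply: le_trans (_ : \sum_(0 <= i < (2 * n).+1) \sum_(0 <= l < (2 * n).+1)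
   (1 + `|x + i%:R| ^+ 2 + (l%:R / 2) ^+ 2)^-1 <= _).
  apply: ler_sum => i _; under eq_bigr do rewrite E.
  apply: (@sum_unit_spaced (fun s => (1 + `|x + i%:R| ^+ 2 + s ^+ 2)^-1)).
  by apply: hdec; apply: sqr_ge0.
rewrite exchange_big [leRHS]exchange_big /=; apply: ler_sum => l _.
apply: (@sum_unit_spaced (fun s => (1 + s ^+ 2 + (l%:R / 2) ^+ 2)^-1)) => s t s0 st.
by rewrite (addrAC 1 (t ^+ 2)) (addrAC 1 (s ^+ 2)); apply: hdec => //; apply: sqr_ge0.
Qed.

Definition latt n z : C :=
  \sum_(0 <= i < (2 * n).+1) \sum_(0 <= j < (2 * n).+1) kern (z - node n i j).

(** Multiplication by ['i] permutes the nodes of the centred square, and [kern] turns by [- 'i]. *)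
Lemma lattI n z : latt n ('i * z) = - 'i * latt n z.
Proof.
rewrite /latt exchange_big /= mulr_sumr; apply: eq_bigr => j _.
rewrite big_nat_rev mulr_sumr big_nat [RHS]big_nat; apply: eq_bigr => i /andP[_ hi].
rewrite -kernI; congr kern.
rewrite add0n subSS /node natrB; last by rewrite -ltnS.
rewrite natrM; have := sqrCi R[i]; rewrite expr2 => hi2; ring: hi2.
Qed.

Lemma latt0 n : latt n 0 = 0.
Proof.
have := lattI n 0; rewrite mulr0 => h.
have /eqP : (1 + 'i) * latt n 0 = 0 by rewrite mulrDl mul1r {1}h mulNr addNr.
rewrite mulf_eq0 => /orP[|/eqP //]; rewrite addr_eq0 => /eqP h1.
have := sqrCi R[i]; rewrite -[X in X ^+ 2]opprK -h1 sqrrN expr1n => /eqP.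
by rewrite -subr_eq0 opprK -(natrD _ 1 1) pnatr_eq0.
Qed.

(** Start of the induction in [latt_err_quadrant]: as [latt n 0] vanishes by symmetry, only the
    variation of the kernel between [0] and [z] counts. *)
Lemma latt_small n z : md z <= 2 -> md (latt n z) <= 7200 * Num.sqrt (2 * n).+1%:R.
Proof.
move=> hz; rewrite -[latt n z]subr0 -(latt0 n) /latt -sumrB.
under eq_bigr do rewrite -sumrB.
apply: le_trans (md_sum _ _) _.
apply: le_trans (_ : 300 * \sum_(0 <= i < (2 * n).+1) \sum_(0 <= j < (2 * n).+1)
    (1 + md (0 - node n i j) ^+ 2)^-1 <= _); last by have := node_sum n 0; lra.
rewrite mulr_sumr; apply: ler_sum => i _.
apply: le_trans (md_sum _ _) _; rewrite mulr_sumr; apply: ler_sum => j _.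
by have -> : z - node n i j = (0 - node n i j) + z by [ring]; apply: kern_lip.
Qed.

Definition lcoef n : R := \sum_(0 <= j < (2 * n).+1) 2 * n%:R / (n%:R ^+ 2 + (j%:R - n%:R) ^+ 2).

End Lattice.

(** * The lattice sum as an approximate multiple of conjugation *)

Section LatticeSum.
Variable R : realType.
Local Notation C := (cplx R).
Implicit Types (z w u : C) (n : nat).

Lemma lcoef_bounds n : (0 < n)%N -> 2 <= lcoef R n <= 6.
Proof.
move=> n0; have n1 : 1 <= n%:R :> R by rewrite ler1n.
have hS : (2 * n).+1%:R = 2 * n%:R + 1 :> R by rewrite -natr1 natrM.
have hj j : (0 <= j < (2 * n).+1)%N -> 0 <= (j%:R - n%:R : R) ^+ 2 <= n%:R ^+ 2.
  move=> /andP[_ hj]; rewrite sqr_ge0 /=.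
  have : j%:R <= (2 * n)%:R :> R by rewrite ler_nat -ltnS.
  by rewrite natrM => h; have : 0 <= j%:R :> R by []; nra.
have hp (b : R) : 0 <= b -> 0 < n%:R ^+ 2 + b by move=> b0; nra.
apply/andP; split.
  apply: le_trans (_ : \sum_(0 <= j < (2 * n).+1) n%:R^-1 <= _).
    by rewrite sumr_const_nat subn0 -(mulr_natl n%:R^-1) hS ler_pdivlMr; lra.
  rewrite /lcoef big_nat [leRHS]big_nat; apply: ler_sum => j /hj /andP[h1 h2].
  by rewrite ler_pdivlMr ?hp // mulrC ler_pdivrMr; [nra | lra].
apply: le_trans (_ : \sum_(0 <= j < (2 * n).+1) (2 / n%:R) <= _); last first.
  by rewrite sumr_const_nat subn0 -(mulr_natl (2 / n%:R)) hS mulrA ler_pdivrMr; lra.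
rewrite /lcoef big_nat [leRHS]big_nat; apply: ler_sum => j /hj /andP[h1 h2].
rewrite ler_pdivrMr ?hp // mulrAC ler_pdivlMr; last by lra.
by nra.
Qed.

Lemma kern_far_shift (x : R) (w v : C) : 20 <= x -> x <= md w -> md v <= x / 2 ->
  md (kern (w + v) - w^-1) <= 2 * md v / x ^+ 2.
Proof.
move=> hx hw hv; have h1 := md_ge_add w v; have v0 := md_ge0 v.
rewrite /kern ifT; last by lra.
have nw : w != 0 by rewrite -md_gt0; lra.
have nwv : w + v != 0 by rewrite -md_gt0; lra.
have -> : (w + v)^-1 - w^-1 = - v / ((w + v) * w) by field; rewrite nw nwv.
rewrite md_div mdN mdM ler_pdivrMr; last by apply: mulr_gt0; lra.
rewrite mulrAC ler_pdivlMr; last by nra.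
have h3 : x / 2 * x <= md (w + v) * md w by apply: ler_pM; lra.
have h4 : md v * (x / 2 * x) <= md v * (md (w + v) * md w) by apply: ler_wpM2l.
by lra.
Qed.

(** A shift by 1 telescopes along each row of nodes, leaving one term at either edge of the square.
    These are at distance at least [n] from the origin, so replacing [z] and [z + 1] by 0 in them
    costs [O(M / n ^ 2)] per row; what remains is exactly the summand of [lcoef]. *)
Lemma lattD1 n (M : R) z : 1 <= M -> 2 * M + 20 <= n%:R -> md z <= M ->
  md (latt n (z + 1) - latt n z - ((lcoef R n)%:C)%C) <= 18 * M / n%:R.
Proof.
move=> M1 hn hz.
have n0 : 0 < n%:R :> R by lra.
rewrite /latt exchange_big [X in _ - X - _]exchange_big /= -sumrB /lcoef.
rewrite raddf_sum /= -sumrB.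
apply: le_trans (md_sum _ _) _.
apply: le_trans (_ : \sum_(0 <= j < (2 * n).+1) 2 * (2 * M + 1) / n%:R ^+ 2 <= _); last first.
  rewrite sumr_const_nat subn0 -(mulr_natl (_ / _)) -natr1 natrM.
  rewrite expr2 invfM !mulrA ler_pM2r ?invr_gt0 // ler_pdivrMr //.
  have h : (2 * n%:R + 1) * 2 * (2 * M + 1) <= (3 * n%:R) * 2 * (3 * M).
    by apply: ler_pM; lra.
  by lra.
apply: ler_sum => j _.
set b : C := j%:R - n%:R.
pose f i : C := kern (z + 1 - node R n i j).
have -> : \sum_(0 <= i < (2 * n).+1) kern (z + 1 - node R n i j) -
  \sum_(0 <= i < (2 * n).+1) kern (z - node R n i j) = f 0%N - f (2 * n).+1.
  rewrite -sumrB -opprB -telescope_sumr // -sumrN; apply: eq_bigr => i _.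
  rewrite opprB /f; congr (_ - kern _).
  by rewrite /node -natr1; ring.
have hf0 : f 0%N = kern ((n%:R - 'i * b) + (z + 1)).
  by rewrite /f /node -/b; congr kern; ring.
have hf1 : f (2 * n).+1 = kern (- (n%:R + 'i * b) + z).
  by rewrite /f /node -/b -natr1 natrM; congr kern; ring.
have hRe (c : C) : complex.Im c = 0 -> n%:R <= md (n%:R + 'i * c).
  move=> hc; apply: le_trans (Re_le_md _).
  by rewrite ReD ReiM hc Re_nat oppr0 addr0 ler_norm.
have hb : complex.Im b = 0 by rewrite /b ImD ImN !Im_nat subr0.
have hp := hRe _ hb.
have hm : n%:R <= md (n%:R - 'i * b) by rewrite -mulrN hRe // ImN hb oppr0.
have hz1 : md (z + 1) <= M + 1 by apply: le_trans (mdD _ _) _; rewrite md1; lra.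
have k0 : md (f 0%N - (n%:R - 'i * b)^-1) <= 2 * md (z + 1) / n%:R ^+ 2.
  by rewrite hf0; apply: kern_far_shift => //; lra.
have k1 : md (f (2 * n).+1 - (- (n%:R + 'i * b))^-1) <= 2 * md z / n%:R ^+ 2.
  by rewrite hf1; apply: kern_far_shift; rewrite ?mdN //; lra.
have np : n%:R + 'i * b != 0 by rewrite -md_gt0; lra.
have nm : n%:R - 'i * b != 0 by rewrite -md_gt0; lra.
have -> : ((2 * n%:R / (n%:R ^+ 2 + (j%:R - n%:R) ^+ 2))%:C)%C =
  (n%:R - 'i * b)^-1 - (- (n%:R + 'i * b))^-1.
  rewrite rmorphM fmorphV rmorphM (rmorphD _ (n%:R ^+ 2)) !rmorphXn rmorphB !rmorph_nat -/b.
  have -> : n%:R ^+ 2 + b ^+ 2 = (n%:R + 'i * b) * (n%:R - 'i * b) :> C.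
    by have := sqrCi R[i]; rewrite !expr2 => hi2; ring: hi2.
  by field; rewrite np nm.
have -> : f 0%N - f (2 * n).+1 - ((n%:R - 'i * b)^-1 - (- (n%:R + 'i * b))^-1) =
  (f 0%N - (n%:R - 'i * b)^-1) - (f (2 * n).+1 - (- (n%:R + 'i * b))^-1) by ring.
apply: le_trans (mdD _ _) _; rewrite mdN.
apply: le_trans (lerD k0 k1) _.
by rewrite -mulrDl -mulrDr ler_pM2r ?invr_gt0 ?exprn_gt0 //; lra.
Qed.

(* [lcoef R n] is the increment c of the header; it tends to pi. *)
Definition latt_err n z : C := latt n z - ((lcoef R n)%:C)%C * z^*.

Lemma latt_errI n z : md (latt_err n ('i * z)) = md (latt_err n z).
Proof.
have -> : latt_err n ('i * z) = - 'i * latt_err n z.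
  by rewrite /latt_err lattI rmorphM /= conjCi; ring.
by rewrite mdM mdN md_i mul1r.
Qed.

Lemma latt_errD1 n (M : R) z : 1 <= M -> 2 * M + 20 <= n%:R -> md z <= M ->
  md (latt_err n (z + 1)) <= md (latt_err n z) + 18 * M / n%:R.
Proof.
move=> M1 hn hz; rewrite -lerBlDl; apply: le_trans (md_ge_sub _ _) _.
have -> : latt_err n (z + 1) - latt_err n z = latt n (z + 1) - latt n z - ((lcoef R n)%:C)%C.
  by rewrite /latt_err rmorphD /= rmorph1; ring.
exact: lattD1.
Qed.

Lemma latt_errDi n (M : R) z : 1 <= M -> 2 * M + 20 <= n%:R -> md z <= M ->
  md (latt_err n (z + 'i)) <= md (latt_err n z) + 18 * M / n%:R.
Proof.
move=> M1 hn hz.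
have e u : 'i * (- 'i * u) = u by rewrite mulrA mulrN -expr2 sqrCi opprK mul1r.
have -> : z + 'i = 'i * (- 'i * z + 1) by rewrite mulrDr e mulr1.
rewrite latt_errI -{2}(e z) latt_errI; apply: latt_errD1 => //.
by rewrite mdM mdN md_i mul1r.
Qed.

(** In the first quadrant a step back by 1 or by ['i], taken while the corresponding coordinate is
    at least 1, decreases the modulus, so the walk towards the unit square stays where [lattD1]
    applies. The 12 bounds [lcoef R n * md z] for [md z <= 2]. *)
Lemma latt_err_quadrant n (M : R) (k : nat) z : 1 <= M -> 2 * M + 20 <= n%:R ->
  0 <= complex.Re z -> 0 <= complex.Im z -> md z <= M ->
  complex.Re z + complex.Im z <= k%:R ->
  md (latt_err n z) <= 7200 * Num.sqrt (2 * n).+1%:R + 12 + k%:R * (18 * M / n%:R).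
Proof.
move=> M1 hn; have n0 : (0 < n)%N by rewrite -(ltr0n R); lra.
have d0 : 0 <= 18 * M / n%:R by rewrite divr_ge0 ?ler0n //; lra.
have base u : md u <= 2 -> md (latt_err n u) <= 7200 * Num.sqrt (2 * n).+1%:R + 12.
  move=> hu; apply: le_trans (mdD _ _) _; rewrite mdN mdM md_real mdJ.
  have /andP[c1 c2] := lcoef_bounds n0.
  rewrite ger0_norm; last by lra.
  have := latt_small n hu; have := md_ge0 u; nra.
move: (7200 * Num.sqrt _ + 12) base => B base.
have D1 := latt_errD1 M1 hn; have Di := latt_errDi M1 hn.
move: (18 * M / n%:R) d0 D1 Di => d d0 D1 Di; clear hn.
elim: k z => [|k IH] z x0 y0 hz hk.
  rewrite mul0r addr0; apply: base; apply: le_trans (md_le_ReIm _) _.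
  by rewrite !ger0_norm //; lra.
have hk' : complex.Re z + complex.Im z - 1 <= k%:R by rewrite lerBlDr natr1.
have hsub u : complex.Re u ^+ 2 + complex.Im u ^+ 2 <= complex.Re z ^+ 2 + complex.Im z ^+ 2 -> md u <= M.
  by rewrite -!md_sqr ler_pXn2r ?nnegrE ?md_ge0 // => /le_trans; apply.
rewrite -[k.+1%:R]natr1 (mulrDl k%:R) mul1r addrA.
have [x1|x1] := leP 1 (complex.Re z).
  rewrite -(subrK 1 z).
  have hx : complex.Re (z - 1) = complex.Re z - 1 by rewrite ReD ReN (Re_nat R 1).
  have hy : complex.Im (z - 1) = complex.Im z by rewrite ImD ImN (Im_nat R 1) subr0.
  have hM : md (z - 1) <= M by apply: hsub; rewrite hx hy lerD2r; nra.
  apply: le_trans (D1 _ hM) _; rewrite lerD2r; apply: IH => //; rewrite ?hx ?hy; lra.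
have [y1|y1] := leP 1 (complex.Im z).
  rewrite -(subrK 'i z).
  have hx : complex.Re (z - 'i) = complex.Re z by rewrite ReD ReN iE /= subr0.
  have hy : complex.Im (z - 'i) = complex.Im z - 1 by rewrite ImD ImN iE.
  have hM : md (z - 'i) <= M by apply: hsub; rewrite hx hy lerD2l; nra.
  apply: le_trans (Di _ hM) _; rewrite lerD2r; apply: IH => //; rewrite ?hx ?hy; lra.
have hz2 : md z <= 2 by apply: le_trans (md_le_ReIm _) _; rewrite !ger0_norm //; lra.
have := base _ hz2; have : 0 <= k%:R * d by apply: mulr_ge0.
by lra.
Qed.

(** Quarter turns bring [z] into the first quadrant without changing the modulus of the error. At
    most [2 M + 1 <= 3 M] steps are then made at a cost of [18 M / n] each, whence 54. *)
Lemma latt_approx n (M : R) z : 1 <= M -> 2 * M + 20 <= n%:R -> md z <= M ->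
  md (latt_err n z) <= 7200 * Num.sqrt (2 * n).+1%:R + 12 + 54 * M ^+ 2 / n%:R.
Proof.
move=> M1 hn.
have n0 : 0 < n%:R :> R by lra.
have quad u : 0 <= complex.Re u -> 0 <= complex.Im u -> md u <= M ->
  md (latt_err n u) <= 7200 * Num.sqrt (2 * n).+1%:R + 12 + 54 * M ^+ 2 / n%:R.
  move=> x0 y0 hu; have k0 : 0 <= 2 * M by lra.
  have /andP[k1 k2] := truncn_itv k0.
  have hk : complex.Re u + complex.Im u <= (Num.truncn (2 * M)).+1%:R.
    have := Re_le_md u; have := Im_le_md u; rewrite !ger0_norm //; lra.
  apply: le_trans (latt_err_quadrant M1 hn x0 y0 hu hk) _.
  rewrite lerD2l mulrA ler_pM2r ?invr_gt0 //.
  have : (Num.truncn (2 * M)).+1%:R <= 3 * M by rewrite -natr1; lra.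
  by move=> h; nra.
have md_iM u : md ('i * u) = md u by rewrite mdM md_i mul1r.
move=> hz; have [x0|x0] := leP 0 (complex.Re z); have [y0|y0] := leP 0 (complex.Im z).
- exact: quad.
- rewrite -latt_errI; apply: quad; rewrite ?ReiM ?ImiM ?md_iM //; lra.
- rewrite -3!latt_errI; apply: quad; rewrite ?(ReiM, ImiM) ?md_iM //; lra.
- rewrite -2!latt_errI; apply: quad; rewrite ?(ReiM, ImiM) ?md_iM //; lra.
Qed.

End LatticeSum.

Lemma geometric_le (R : realType) (b e : R) : 0 < e -> exists n : nat, b * 2^-1 ^+ n <= e.
Proof.
move=> e0; pose n := (Num.truncn (`|b| / e)).+1; exists n.
  have hb : `|b| / e < n%:R by exact: truncnS_gt.
  have hn : n%:R <= 2 ^+ n :> R by rewrite -natrX ler_nat ltnW // ltn_expl.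
  rewrite exprVn ler_pdivrMr ?exprn_gt0 //.
  move: hb; rewrite ltr_pdivrMr // => hb.
  by have := ler_norm b; have : n%:R * e <= 2 ^+ n * e by [rewrite ler_pM2r]; lra.
Qed.

(** * The uniform closure of the polynomials on a bounded set *)

Section PolynomialClosure.
Variables (R : realType).
Local Notation C := (cplx R).
Variable K : set C.

Definition poly_approx (f : C -> C) : Prop :=
  forall e : R, 0 < e -> exists q : {poly C}, forall z, K z -> md (f z - q.[z]) <= e.

Lemma poly_approx_lim f :
  (forall e : R, 0 < e -> exists2 g, poly_approx g & forall z, K z -> md (f z - g z) <= e) ->
  poly_approx f.
Proof.
move=> h e e0; have e2 : 0 < e / 2 by lra.
have [g hg hfg] := h _ e2; have [q hq] := hg _ e2; exists q => z Kz.
apply: le_trans (md_triangle (g z) _ _) _.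
have := hfg _ Kz; have := hq _ Kz; lra.
Qed.

Lemma poly_approx_ext f g : {in K, f =1 g} -> poly_approx f -> poly_approx g.
Proof.
move=> fg hf e e0; have [q hq] := hf e e0; exists q => z Kz.
by rewrite -fg ?inE //; apply: hq.
Qed.

Lemma poly_approx_poly (q : {poly C}) : poly_approx (fun z => q.[z]).
Proof. by move=> e e0; exists q => z _; rewrite subrr md0 ltW. Qed.

Lemma poly_approx_cst c : poly_approx (fun=> c).
Proof. by apply: poly_approx_ext (poly_approx_poly c%:P) => z _; rewrite hornerC. Qed.

Lemma poly_approx_id : poly_approx id.
Proof. by apply: poly_approx_ext (poly_approx_poly 'X) => z _; rewrite hornerX. Qed.

Lemma poly_approxD f g : poly_approx f -> poly_approx g -> poly_approx (fun z => f z + g z).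
Proof.
move=> hf hg e e0; have e2 : 0 < e / 2 by lra.
have [p hp] := hf _ e2; have [q hq] := hg _ e2; exists (p + q) => z Kz.
have -> : f z + g z - (p + q).[z] = (f z - p.[z]) + (g z - q.[z]) by rewrite hornerD; ring.
apply: le_trans (mdD _ _) _; have := hp _ Kz; have := hq _ Kz; lra.
Qed.

Lemma poly_approx_sum (m n : nat) (F : nat -> C -> C) :
  (forall i, poly_approx (F i)) -> poly_approx (fun z => \sum_(m <= i < n) F i z).
Proof.
move=> hF; elim: (index_iota m n) => [|i s IH].
  by apply: poly_approx_ext (poly_approx_cst 0) => z _; rewrite big_nil.
by apply: poly_approx_ext (poly_approxD (hF i) IH) => z _; rewrite big_cons.
Qed.

Hypothesis Kbounded : exists B : R, forall z, K z -> md z <= B.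

Lemma poly_approx_bounded f : poly_approx f -> exists2 b : R, 0 < b & forall z, K z -> md (f z) <= b.
Proof.
have [B hB] := Kbounded.
move=> /(_ 1 ltr01) [q hq].
have [b b0 hb] : exists2 b : R, 0 <= b & forall z, K z -> md q.[z] <= b.
  elim/poly_ind: (q) => [|p c [b b0 hb]].
    by exists 0 => // z _; rewrite horner0 md0.
  exists (b * `|B| + md c) => [|z Kz]; first by rewrite addr_ge0 ?mulr_ge0 ?md_ge0.
  rewrite hornerMXaddC; apply: le_trans (mdD _ _) _; rewrite lerD2r mdM.
  by apply: ler_pM; rewrite ?md_ge0 ?hb // (le_trans (hB _ Kz)) ?ler_norm.
exists (b + 1) => [|z Kz]; first by rewrite ltr_wpDl.
rewrite -(subrK q.[z] (f z)) addrC; apply: le_trans (mdD _ _) _.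
by have := hq _ Kz; have := hb _ Kz; lra.
Qed.

Lemma poly_approxM f g : poly_approx f -> poly_approx g -> poly_approx (fun z => f z * g z).
Proof.
move=> hf hg; have [b b0 hb] := poly_approx_bounded hf.
have [c c0 hc] := poly_approx_bounded hg.
move=> e e0; pose d := Num.min 1 (e / (b + c + 1)).
have s0 : 0 < b + c + 1 by lra.
have d0 : 0 < d by rewrite /d lt_min ltr01 divr_gt0.
have d1 : d <= 1 by rewrite /d ge_min lexx.
have de : d * (b + c + 1) <= e by rewrite -ler_pdivlMr // /d ge_min lexx orbT.
have [p hp] := hf _ d0; have [q hq] := hg _ d0; exists (p * q) => z Kz.
have -> : f z * g z - (p * q).[z] =
  f z * (g z - q.[z]) + (f z - p.[z]) * g z - (f z - p.[z]) * (g z - q.[z]).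
  by rewrite hornerM; ring.
apply: le_trans (mdD _ _) _; apply: le_trans (lerD (mdD _ _) (lexx _)) _.
rewrite mdN !mdM.
have h1 : md (f z) * md (g z - q.[z]) <= b * d by apply: ler_pM; rewrite ?md_ge0 ?hb ?hq.
have h2 : md (f z - p.[z]) * md (g z) <= d * c by apply: ler_pM; rewrite ?md_ge0 ?hc ?hp.
have h3 : md (f z - p.[z]) * md (g z - q.[z]) <= d * 1.
  by apply: ler_pM; rewrite ?md_ge0 ?hp // (le_trans (hq _ Kz)).
by nra.
Qed.

Lemma poly_approx_geometric f (b : R) (g : nat -> C -> C) :
  (forall n, poly_approx (g n)) ->
  (forall n z, K z -> md (f z - g n z) <= b * 2^-1 ^+ n) -> poly_approx f.
Proof.
move=> hg hfg; apply: poly_approx_lim => e e0.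
have [n hn] := geometric_le b e0.
by exists (g n) => // z Kz; apply: le_trans (hfg n z Kz) hn.
Qed.

(** Neumann series: its partial sums are the iterates of [v -> 1 + u v], and each iteration halves
    the error. *)
Lemma poly_approx_inv1B u : poly_approx u -> (forall z, K z -> md (u z) <= 1 / 2) ->
  poly_approx (fun z => (1 - u z)^-1).
Proof.
move=> hu bu; pose g n z := iter n (fun v => 1 + u z * v) 0.
apply: (@poly_approx_geometric _ 2 g) => [n|n z Kz].
  elim: n => [|n IH]; first exact: poly_approx_cst.
  by apply: poly_approxD; [apply: poly_approx_cst | apply: poly_approxM].
have nu : 1 / 2 <= md (1 - u z).
  by have := md_ge_sub 1 (u z); rewrite md1; have := bu _ Kz; lra.
have nz : 1 - u z != 0 by rewrite -md_gt0; lra.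
elim: n => [|n IH].
  by rewrite /g /= subr0 expr0 mulr1 mdV -[leRHS]invrK lef_pV2 ?posrE ?invr_gt0 //; lra.
have -> : (1 - u z)^-1 - g n.+1 z = u z * ((1 - u z)^-1 - g n z).
  by rewrite [g n.+1 z]/g iterS -/(g n z); field.
by rewrite mdM exprS mulrCA; apply: ler_pM; rewrite ?md_ge0 // -div1r bu.
Qed.

(** The factor [s + 1] of [s ^ 2 - 1] has real part at least 1. Knowing the half plane of a root
    thus turns control of its square into control of the root. *)
Lemma md_sqrt_near1 (s : C) : 0 <= complex.Re s -> md (s - 1) <= md (s ^+ 2 - 1).
Proof.
move=> hs; have -> : s ^+ 2 - 1 = (s - 1) * (s + 1) by ring.
rewrite mdM ler_peMr ?md_ge0 //; apply: le_trans (Re_le_md _).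
by rewrite ReD (Re_nat R 1) ger0_norm; lra.
Qed.

(* The branch is the limit of the iteration v -> (u - v ^ 2) / 2, whose fixed point is sqrt (1 + u) - 1. *)
Lemma poly_approx_sqrt1D u : poly_approx u -> (forall z, K z -> md (u z) <= 1 / 2) ->
  exists s : C -> C, [/\ poly_approx s, forall z, s z ^+ 2 = 1 + u z &
     forall z, 0 <= complex.Re (s z)].
Proof.
move=> hu bu.
pose s z : C := let w := sqrtC (1 + u z) in if 0 <= complex.Re w then w else - w.
have s2 z : s z ^+ 2 = 1 + u z by rewrite /s /=; case: ifP; rewrite ?sqrrN sqrtCK.
have sR z : 0 <= complex.Re (s z).
  by rewrite /s /=; case: ifP => // /negbT; rewrite -ltNge ReN; lra.
exists s; split => //.
pose v n z : C := iter n (fun v => (u z - v ^+ 2) * 2^-1) 0.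
have hv n : poly_approx (v n).
  elim: n => [|n IH]; first exact: poly_approx_cst.
  apply: (@poly_approx_ext (fun z => (u z + (-1) * (v n z * v n z)) * 2^-1)).
    by move=> z _; rewrite [v n.+1 z]/v iterS -/(v n z) mulN1r expr2.
  apply: poly_approxM; last exact: poly_approx_cst.
  by apply: poly_approxD => //; apply: poly_approxM; [apply: poly_approx_cst | apply: poly_approxM].
apply: (@poly_approx_geometric _ 1 (fun n z => 1 + v n z)) => [n|n z Kz].
  by apply: poly_approxD => //; apply: poly_approx_cst.
have md2 : md 2^-1 = 2^-1 :> R by rewrite mdV md_nat.
have hs1 : md (s z - 1) <= 1 / 2.
  apply: le_trans (md_sqrt_near1 (sR z)) _.
  by rewrite s2 addrAC subrr add0r bu.
have vb k : md (v k z) <= 1 / 2.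
  elim: k => [|k IH]; first by rewrite /v /= md0; lra.
  rewrite /v iterS -/(v k z) mdM md2.
  have := mdD (u z) (- v k z ^+ 2); rewrite mdN mdX.
  by have := bu _ Kz; have := md_ge0 (v k z); nra.
rewrite mul1r opprD addrA.
elim: n => [|n IH]; first by rewrite /v /= subr0 expr0; lra.
(* The contraction factor [(v + (s - 1)) / 2] is at most [1 / 2], since both summands have modulus
   at most [1 / 2]. *)
have -> : s z - 1 - v n.+1 z = ((v n z + (s z - 1)) * 2^-1) * - (s z - 1 - v n z).
  have -> : s z - 1 - v n.+1 z = s z - 1 - (u z - v n z ^+ 2) * 2^-1 by rewrite /v iterS.
  have -> : u z = s z ^+ 2 - 1 by rewrite s2; ring.
  by field.
rewrite mdM mdN exprS; apply: ler_pM; rewrite ?md_ge0 //.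
rewrite mdM md2 ler_piMl ?invr_ge0 //; apply: le_trans (mdD _ _) _.
by have := vb n; lra.
Qed.

End PolynomialClosure.

(** * Poles, square roots and the substitute kernel off a Lavrentieff set *)

Section LavrentieffSet.
Variables (R : realType).
Local Notation C := (cplx R).
Variable K : set C.
Hypothesis Kbounded : exists B : R, forall z, K z -> md z <= B.
Hypothesis Kclosed : forall w, ~ K w -> exists2 d : R, 0 < d & forall z, K z -> d <= md (z - w).
Hypothesis Kempty_interior : forall (w : C) (r : R), 0 < r -> exists2 a : C, ~ K a & md (a - w) <= r.
Hypothesis Kcompl_connected : forall U : set C, (exists w, U w) -> (forall w, U w -> ~ K w) ->
  (forall w, U w -> exists2 d : R, 0 < d & forall w', md (w' - w) < d -> U w') ->
  (forall w, ~ K w -> ~ U w -> exists2 d : R, 0 < d & forall w', md (w' - w) < d -> ~ U w') ->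
  forall w, ~ K w -> U w.

Lemma compl_unbounded (b : R) : exists2 w : C, ~ K w & b <= md w.
Proof.
have [B hB] := Kbounded; exists ((`|b| + `|B| + 1)%:C)%C.
  move=> /hB; rewrite md_real ger0_norm ?addr_ge0 //.
  by have := ler_norm B; have := normr_ge0 b; lra.
rewrite md_real ger0_norm ?addr_ge0 //.
by have := ler_norm b; have := normr_ge0 B; lra.
Qed.

(** Makes [(w' - w) / (z - w)] and [(w' - w) / (z - w')] at most [1 / 2] in modulus on [K], the
    range of the inverse and square root iterations: moving a pole uses the first quotient, linking
    roots the second. *)
Definition near_compl (w w' : C) : Prop :=
  exists2 d : R, 0 < d & (forall z, K z -> d <= md (z - w) /\ d <= md (z - w')) /\ md (w' - w) <= d / 2.

Lemma near_compl_sym w w' : near_compl w w' -> near_compl w' w.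
Proof.
by move=> [d d0 [h1 h2]]; exists d => //; split; [move=> z /h1[] | rewrite mdB].
Qed.

Lemma near_compl_notin w w' : near_compl w w' -> ~ K w'.
Proof. by move=> [d d0 [h1 h2]] /h1[_]; rewrite subrr md0; lra. Qed.

(** Close enough points off [K] are linked by [near_compl] in both directions, so membership in [U]
    is locally constant on the complement and connectedness applies. The radius may depend on the
    point, as [disc_branch] requires inside its disc. *)
Lemma compl_chain (U : set C) : (exists w, U w) -> (forall w, U w -> ~ K w) ->
  (forall w, ~ K w -> exists2 r : R, 0 < r & forall w1 w2,
     md (w1 - w) < r -> md (w2 - w) < r -> near_compl w1 w2 -> U w1 -> U w2) ->
  forall w, ~ K w -> U w.
Proof.
move=> U0 UK Ustep.
have loc w : ~ K w -> exists2 d : R, 0 < d & forall w', md (w' - w) < d -> (U w <-> U w').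
  move=> nK; have [d d0 hd] := Kclosed nK; have [r r0 hr] := Ustep _ nK.
  exists (Num.min r (d / 4)) => [|w']; first by rewrite lt_min r0 divr_gt0.
  rewrite lt_min => /andP[h1 h2].
  have hn : near_compl w w'.
    exists (3 / 4 * d); first by lra.
    split; last by lra.
    by move=> z Kz; have := hd _ Kz; have := md_triangle w' z w; split; lra.
  have h0 : md (w - w) < r by rewrite subrr md0.
  by split; apply: hr => //; apply: near_compl_sym.
apply: Kcompl_connected => // w => [Uw|nK nU].
  by have [d d0 hd] := loc _ (UK _ Uw); exists d => // w' /hd <-.
by have [d d0 hd] := loc _ nK; exists d => // w' /hd <-.
Qed.

(** Runge's pole pushing: [1 / (z - w2)] is [1 / (z - w1)] times the inverse of
    [1 - (w2 - w1) / (z - w1)]. The chain starts at a pole so remote that [z / w] has modulus at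
    most [1 / 2] on [K]. *)
Lemma poly_approx_pole w : ~ K w -> poly_approx K (fun z => (z - w)^-1).
Proof.
have step w1 w2 : poly_approx K (fun z => (z - w1)^-1) -> near_compl w1 w2 ->
    poly_approx K (fun z => (z - w2)^-1).
  move=> h1 hn; have nK2 := near_compl_notin hn; case: hn => d d0 [hd' hd2].
  have hd z (Kz : K z) := (hd' z Kz).1.
  pose u z := (z - w1)^-1 * (w2 - w1).
  have hu : poly_approx K u by apply: poly_approxM => //; apply: poly_approx_cst.
  have bu z : K z -> md (u z) <= 1 / 2.
    move=> Kz; have hz := hd _ Kz; rewrite mdM mdV mulrC ler_pdivrMr; last by lra.
    by lra.
  have := poly_approxM Kbounded h1 (poly_approx_inv1B Kbounded hu bu).
  apply: poly_approx_ext => z; rewrite inE => Kz.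
  have n1 : z - w1 != 0 by rewrite -md_gt0; have := hd _ Kz; lra.
  have n2 : z - w2 != 0 by rewrite subr_eq0; apply/eqP => zw; apply: nK2; rewrite -zw.
  have n3 : 1 - u z = (z - w2) / (z - w1) by rewrite /u; field.
  by rewrite n3 invf_div; field; rewrite n1 n2.
move=> nKw; suff [] : ~ K w /\ poly_approx K (fun z => (z - w)^-1) by [].
move: w nKw; apply: (@compl_chain [set w | ~ K w /\ poly_approx K (fun z => (z - w)^-1)]).
- have [B hB] := Kbounded; have [w nKw hw] := compl_unbounded (2 * `|B| + 1).
  exists w; split => //.
  have w0 : 0 < md w by have := normr_ge0 B; lra.
  have nw : w != 0 by rewrite -md_gt0.
  pose u z := z * w^-1.
  have hu : poly_approx K u by apply: poly_approxM => //; [apply: poly_approx_id | apply: poly_approx_cst].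
  have bu z : K z -> md (u z) <= 1 / 2.
    move=> Kz; have hz := hB _ Kz; rewrite mdM mdV ler_pdivrMr //.
    by have := ler_norm B; lra.
  have := poly_approxM Kbounded (poly_approx_cst K (- w^-1)) (poly_approx_inv1B Kbounded hu bu).
  apply: poly_approx_ext => z; rewrite inE => Kz.
  have n1 : z - w != 0 by rewrite subr_eq0; apply/eqP => zw; apply: nKw; rewrite -zw.
  have n3 : 1 - u z = - (z - w) / w by rewrite /u; field.
  by rewrite n3 invf_div; field; rewrite n1 nw.
- by move=> w [].
- move=> w nK; exists 1 => // w1 w2 _ _ hn [nK1 hw1]; split; first exact: near_compl_notin hn.
  exact: step hn.
Qed.

(** A branch on [K] of the square root of [(z - w) / (z - w')], within the uniform closure of the
    polynomials. *)
Definition root_link (w w' : C) (s : C -> C) : Prop :=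
  poly_approx K s /\ forall z, K z -> s z ^+ 2 * (z - w') = z - w.

Lemma root_link_near w w' : near_compl w w' ->
  exists2 s, root_link w w' s & forall z, 0 <= complex.Re (s z).
Proof.
move=> hn; have nK' := near_compl_notin hn; case: hn => d d0 [hd' hd2].
have hd z (Kz : K z) := (hd' z Kz).2.
pose u z := (z - w')^-1 * (w' - w).
have hu : poly_approx K u.
  by apply: poly_approxM => //; [apply: poly_approx_pole | apply: poly_approx_cst].
have bu z : K z -> md (u z) <= 1 / 2.
  by move=> Kz; have hz := hd _ Kz; rewrite mdM mdV mulrC ler_pdivrMr; lra.
have [s [h1 h2 h3]] := poly_approx_sqrt1D Kbounded hu bu.
exists s => //; split => // z Kz; rewrite h2 /u.
have n1 : z - w' != 0 by rewrite -md_gt0; have := hd _ Kz; lra.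
by field.
Qed.

Lemma root_link_trans w1 w2 w3 s t : root_link w1 w2 s -> root_link w2 w3 t ->
  root_link w1 w3 (fun z => s z * t z).
Proof.
move=> [s1 s2] [t1 t2]; split; first exact: poly_approxM.
by move=> z Kz; rewrite exprMn -mulrA t2 // s2.
Qed.

(** Far from the disc, [s ^ 2 - 1] has modulus at most [2 r / (9 r)]. The bound [1 / 3] lets two
    such roots be multiplied inside the right half plane, because [1 / 9 + 1 / 3 + 1 / 3 < 1]. *)
Lemma root_link_far w w' s (c z : C) (r : R) : root_link w w' s -> ~ K w' -> 0 < r ->
  K z -> md (w - c) <= r -> md (w' - c) <= r -> 10 * r <= md (z - c) ->
  0 <= complex.Re (s z) -> md (s z - 1) <= 1 / 3.
Proof.
move=> [_ hs] nK' r0 Kz hw hw' hz sR; apply: le_trans (md_sqrt_near1 sR) _.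
have n1 : z - w' != 0 by rewrite subr_eq0; apply/eqP => zw; apply: nK'; rewrite -zw.
have -> : s z ^+ 2 - 1 = (w' - w) / (z - w').
  have h : s z ^+ 2 = (z - w) / (z - w') by rewrite -(hs _ Kz) mulfK.
  by rewrite h; field.
have h1 := md_triangle w' z c; have h2 := md_triangle c w' w.
move: h2; rewrite (mdB c w) => h2.
by rewrite md_div ler_pdivrMr; lra.
Qed.

Lemma Re_ge0_near1 (s : C) : md (s - 1) <= 1 -> 0 <= complex.Re s.
Proof.
move=> h; have := le_trans (Re_le_md (s - 1)) h.
by rewrite ReD ReN (Re_nat R 1) ler_norml => /andP[]; lra.
Qed.

(* The complement leaves the disc, being connected and unbounded.  Continued along a path of
   the complement inside the disc, the root of (z - a) / (z - b) stays in the right half plane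
   for z far from the disc, which fixes its branch there. *)
Lemma disc_branch (c : C) (r : R) : 0 < r ->
  exists a b s, [/\ md (a - c) <= r / 4, r / 2 <= md (b - c) <= r,
    ~ K b, root_link a b s &
    forall z, K z -> 10 * r <= md (z - c) -> 0 <= complex.Re (s z)].
Proof.
move=> r0; have r4 : 0 < r / 4 by lra.
have [a nKa ha] := Kempty_interior c r4.
pose good b := [/\ ~ K b, md (b - c) < r & exists2 s, root_link a b s &
  forall z, K z -> 10 * r <= md (z - c) -> 0 <= complex.Re (s z)].
have [[b [[nKb hb [s hs1 hs2]] hb2]]|none] := pselect (exists b, good b /\ r / 2 <= md (b - c)).
  by exists a, b, s; split => //; rewrite hb2 ltW.
(* Otherwise every good point lies within [r / 2] of [c], goodness spreads to the whole complement,
   and this contradicts unboundedness. *)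
exfalso.
have small b : good b -> md (b - c) < r / 2.
  by move=> gb; rewrite ltNge; apply/negP => hb; apply: none; exists b.
have extend b b' s : good b -> ~ K b' -> md (b' - c) < r -> root_link b b' s ->
    (forall z, 0 <= complex.Re (s z)) -> good b'.
  move=> [nKb hb [t t1 t2]] nKb' hb' s1 s2; split => //.
  exists (fun z => t z * s z); first exact: root_link_trans t1 s1.
  move=> z Kz hz.
  have hac : md (a - c) <= r by lra.
  have ht := root_link_far t1 nKb r0 Kz hac (ltW hb) hz (t2 _ Kz hz).
  have hs := root_link_far s1 nKb' r0 Kz (ltW hb) (ltW hb') hz (s2 z).
  apply: Re_ge0_near1.
  have -> : t z * s z - 1 = (t z - 1) * (s z - 1) + (t z - 1) + (s z - 1) by ring.
  apply: le_trans (mdD _ _) _; apply: le_trans (lerD (mdD _ _) (lexx _)) _; rewrite mdM.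
  by have := md_ge0 (t z - 1); have := md_ge0 (s z - 1); nra.
have all_good : forall w, ~ K w -> good w.
  apply: compl_chain.
  - exists a; split => //; first by lra.
    exists (fun=> 1); last by move=> z _ _; rewrite (Re_nat R 1).
    by split; [apply: poly_approx_cst | move=> z _; rewrite expr1n mul1r].
  - by move=> w [].
  - move=> w nKw; have [hw|hw] := ltP (md (w - c)) r.
      exists (r - md (w - c)); first by lra.
      move=> w1 w2 _ hw2 hn gw1; have [s s1 s2] := root_link_near hn.
      apply: extend s1 s2 => //; first exact: near_compl_notin hn.
      by have := md_triangle w w2 c; lra.
    (* Outside the disc the step is vacuous: a good point within [r / 2] of [w] would be at distance
       more than [r / 2] from [c]. *)
    exists (r / 2); first by lra.
    move=> w1 w2 hw1 _ _ /small h.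
    by have := md_triangle w1 w c; rewrite (mdB w w1); lra.
have [w nKw hw] := compl_unbounded (md c + r).
by have := small _ (all_good _ nKw); have := md_ge_sub w c; lra.
Qed.

(* Mergelyan's substitute for the Cauchy kernel: with t ^ 2 = (z - a) (z - b) and m the
   midpoint, (z - m) - t is bounded near the disc and equals (a - b) ^ 2 / (8 (z - m)) to
   leading order away from it. *)
Lemma kernel_approx : exists2 c0 : R, 0 <= c0 & forall (c : C) (r : R), 0 < r ->
  exists2 g, poly_approx K g & forall z, K z ->
    md (((r%:C)%C : C) * g z - kern ((z - c) / ((r%:C)%C : C)))
      <= c0 / (1 + md ((z - c) / ((r%:C)%C : C)) ^+ 2).
Proof.
(* For [md (z - c) < 10 * r], [r * g z] is at most [22 * 8 * 16 = 2816]: [z - m - t] is at most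
   [22 r] and [md (a - b)] at least [r / 4]. The factor 101 bounds [1 + W ^ 2] for [W < 10]. *)
exists (2816 * 101); first by rewrite mulr_ge0 ?ler0n.
move=> c r r0; have [a [b [s [ha /andP[hb1 hb2] nKb [s1 s2] s3]]]] := disc_branch c r0.
set rc : C := ((r%:C)%C : C).
have mdr : md rc = r by rewrite md_real gtr0_norm.
pose m : C := (a + b) / 2; pose t z := (z - b) * s z.
have ht z : K z -> t z ^+ 2 = (z - a) * (z - b).
  by move=> Kz; rewrite -(s2 _ Kz) /t; ring.
pose g z : C := (z - m - t z) * (8 / (a - b) ^+ 2).
have hg : poly_approx K g.
  apply: poly_approxM => //; last exact: poly_approx_cst.
  have -> : (fun z => z - m - t z) = (fun z => (z + (- m)) + (-1) * ((z + (- b)) * s z)).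
    by apply: funext => z; rewrite mulN1r.
  apply: poly_approxD; first by apply: poly_approxD; [apply: poly_approx_id | apply: poly_approx_cst].
  apply: poly_approxM => //; first exact: poly_approx_cst.
  by apply: poly_approxM => //; apply: poly_approxD; [apply: poly_approx_id | apply: poly_approx_cst].
exists g => // z Kz.
have hab : r / 4 <= md (a - b).
  by have := md_triangle a b c; rewrite (mdB b a); lra.
have hab2 : md (a - b) <= 2 * r.
  by have := md_triangle c a b; rewrite (mdB c b); lra.
have nab : a - b != 0 by rewrite -md_gt0; lra.
have hm : md (m - c) <= r.
  have -> : m - c = ((a - c) + (b - c)) * 2^-1 by rewrite /m; field.
  by rewrite mdM mdV md_nat; have := mdD (a - c) (b - c); lra.
have nr : rc != 0 by rewrite -md_gt0 mdr.
have mdz : md ((z - c) / rc) = md (z - c) / r by rewrite md_div mdr.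
rewrite mdz.
have z0 := md_ge0 (z - c).
have [hz|hz] := leP (10 * r) (md (z - c)); last first.
  have W : md (z - c) / r < 10 by rewrite ltr_pdivrMr.
  have W0 : 0 <= md (z - c) / r by rewrite divr_ge0 // ltW.
  rewrite /kern mdz ifF; last by rewrite leNgt W.
  rewrite subr0.
  apply: le_trans (_ : 2816 <= _); last first.
    rewrite ler_pdivlMr; last by nra.
    by rewrite ler_pM2l; [nra | rewrite ltr0n].
  rewrite /g !mdM mdV mdX mdr md_nat.
  have ta : md (t z) <= 11 * r.
    rewrite -(@ler_pXn2r _ 2) ?nnegrE ?md_ge0 //; last by lra.
    rewrite -mdX ht // mdM expr2; apply: ler_pM; rewrite ?md_ge0 //.
      by have := md_triangle c z a; rewrite (mdB c a); lra.
    by have := md_triangle c z b; rewrite (mdB c b); lra.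
  have tb : md (z - m) <= 11 * r by have := md_triangle c z m; rewrite (mdB c m); lra.
  have tc : md (z - m - t z) <= 22 * r by apply: le_trans (mdD _ _) _; rewrite mdN; lra.
  have d0 : 0 < md (a - b) ^+ 2 by rewrite exprn_gt0 //; lra.
  rewrite !mulrA ler_pdivrMr //.
  have h1 : r * md (z - m - t z) <= r * (22 * r) by rewrite ler_pM2l.
  have h2 : r ^+ 2 / 16 <= md (a - b) ^+ 2 by nra.
  by nra.
have sR := s3 _ Kz hz.
have nzb : z - b != 0 by rewrite subr_eq0; apply/eqP => zb; apply: nKb; rewrite -zb.
have hts : md ((z - b) * (s z - 1)) <= 2 * r.
  apply: le_trans hab2; rewrite mdM.
  apply: le_trans (ler_wpM2l (md_ge0 _) (md_sqrt_near1 sR)) _.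
  rewrite -mdM mulrBr mulr1 [_ * s z ^+ 2]mulrC s2 //.
  have -> : z - a - (z - b) = - (a - b) by ring.
  by rewrite mdN.
(* Deviation of [z - m + t z] from [2 * (z - c)]. It stays [O(r)] because [s - 1] is of order
   [r / (z - b)], and it yields the inverse square error. *)
pose e := (c - m) + (c - b) + (z - b) * (s z - 1).
have he : md e <= 4 * r.
  apply: le_trans (mdD _ _) _; apply: le_trans (lerD (mdD _ _) (lexx _)) _.
  by rewrite (mdB c m) (mdB c b); lra.
have hpt : z - m + t z = 2 * (z - c) + e by rewrite /t /e; ring.
have hpt2 : md (z - c) <= md (z - m + t z).
  by rewrite hpt; have := md_ge_add (2 * (z - c)) e; rewrite mdM md_nat; lra.
have npt : z - m + t z != 0 by rewrite -md_gt0; lra.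
have nzc : z - c != 0 by rewrite -md_gt0; lra.
(* Rationalizing with [(z - m) ^ 2 - t ^ 2 = (a - b) ^ 2 / 4] removes the cancellation in
   [z - m - t]. *)
have hgz : g z = 2 / (z - m + t z).
  have hsq : (z - m) ^+ 2 - t z ^+ 2 = (a - b) ^+ 2 / 4 by rewrite ht // /m; field.
  rewrite /g; have -> : z - m - t z = (a - b) ^+ 2 / 4 / (z - m + t z) by rewrite -hsq; field.
  by field; rewrite npt nab.
rewrite /kern mdz ifT; last by rewrite ler_pdivlMr.
have -> : rc * g z - ((z - c) / rc)^-1 = - (rc * e) / ((z - m + t z) * (z - c)).
  have -> : e = z - m + t z - 2 * (z - c) by rewrite hpt; ring.
  by rewrite hgz; field; rewrite npt nzc nr.
rewrite md_div mdN !mdM mdr.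
have hz0 : 0 < md (z - c) by lra.
apply: le_trans (_ : 4 * r ^+ 2 / md (z - c) ^+ 2 <= _).
  rewrite ler_pdivrMr; last by apply: mulr_gt0; lra.
  rewrite mulrAC ler_pdivlMr ?exprn_gt0 //.
  have h1 : r * md e <= r * (4 * r) by rewrite ler_pM2l.
  have h2 : md (z - c) * md (z - c) <= md (z - m + t z) * md (z - c) by rewrite ler_pM2r.
  rewrite expr2; apply: le_trans (ler_wpM2r _ h1) _; first by rewrite mulr_ge0.
  by rewrite [r * _]mulrCA -expr2 ler_wpM2l // mulr_ge0 ?sqr_ge0.
have -> : 4 * r ^+ 2 / md (z - c) ^+ 2 = 4 / (md (z - c) / r) ^+ 2 by field; lra.
have : 10 <= md (z - c) / r by rewrite ler_pdivlMr.
move: (md (z - c) / r) => W hW.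
rewrite ler_pdivrMr; last by rewrite exprn_gt0 //; lra.
rewrite mulrAC ler_pdivlMr; last by have := sqr_ge0 W; lra.
by nra.
Qed.

End LavrentieffSet.

(** * Lavrentieff's theorem for conjugation *)

Section ConjugateApprox.
Variables (R : realType).
Local Notation C := (cplx R).

(** With [n = u ^ 6] and [M = u ^ 4], the errors [sqrt n] and [M ^ 2 / n] are of orders [u ^ 3] and
    [u ^ 2], below [M] by a factor of order [u]. The 3 added to [u] secures [2 M + 20 <= n]. *)
Lemma mesh_choice (a e : R) : 0 <= a -> 0 < e -> exists (n : nat) (M : R),
  [/\ 1 <= M, 2 * M + 20 <= n%:R &
      a * (Num.sqrt (2 * n).+1%:R + 1 + M ^+ 2 / n%:R) <= e * M].
Proof.
move=> a0 e0; pose u := ((Num.truncn (a * 4 / e)).+1 + 3)%N.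
have v3 : 3 <= u%:R :> R by rewrite ler_nat; apply: leq_addl.
have va : a * 4 <= e * u%:R.
  rewrite [leRHS]mulrC -ler_pdivrMr //; apply: ltW.
  by apply: lt_le_trans (truncnS_gt _) _; rewrite ler_nat leq_addr.
exists (u ^ 6)%N, (u%:R ^+ 4); rewrite natrX.
have w : 9 <= u%:R ^+ 2 :> R by nra.
have sq : Num.sqrt (2 * u ^ 6).+1%:R <= 2 * u%:R ^+ 3 :> R.
  have -> : 2 * u%:R ^+ 3 = Num.sqrt ((2 * u%:R ^+ 3) ^+ 2) :> R.
    by rewrite sqrtr_sqr ger0_norm // mulr_ge0 ?exprn_ge0.
  apply: ler_wsqrtr; rewrite -natr1 natrM natrX exprMn -exprM.
  have : 1 <= u%:R ^+ (3 * 2) :> R by rewrite exprn_ege1 //; lra.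
  by lra.
move: (Num.sqrt _) (u%:R : R) v3 va w sq => s v v3 va w sq; split.
- by rewrite exprn_ege1 //; lra.
- rewrite (exprM _ 2 3) (exprM _ 2 2); move: (v ^+ 2) w => {sq}w w9.
  have : 81 <= w ^+ 2 by nra.
  by rewrite (exprS w 2); nra.
have -> : (v ^+ 4) ^+ 2 / v ^+ 6 = v ^+ 2 by field; lra.
have v2 : v ^+ 2 <= v ^+ 3 by rewrite (exprS v 2); nra.
have h : s + 1 + v ^+ 2 <= 4 * v ^+ 3 by lra.
apply: le_trans (ler_wpM2l a0 h) _; rewrite mulrA (exprS v 3) mulrA.
by rewrite ler_wpM2r // exprn_ge0; lra.
Qed.

Lemma poly_approx_conj (K : set C) : (exists B : R, forall z, K z -> md z <= B) ->
  (exists2 c0 : R, 0 <= c0 & forall (c : C) (r : R), 0 < r ->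
    exists2 g, poly_approx K g & forall z, K z ->
      md (((r%:C)%C : C) * g z - kern ((z - c) / ((r%:C)%C : C)))
        <= c0 / (1 + md ((z - c) / ((r%:C)%C : C)) ^+ 2)) ->
  poly_approx K (fun z => z^*).
Proof.
move=> Kbd [c0 c00 hker]; have [B0 hB0] := Kbd.
pose B : R := `|B0| + 1.
have B1 : 1 <= B by rewrite lerDr.
have hB z : K z -> md z <= B by move=> /hB0; have := ler_norm B0; rewrite /B; lra.
apply: poly_approx_lim => e e0.
(* [24 * c0] comes from the kernel errors summed by [node_sum]; 7254 is [7200 + 54] from
   [latt_approx], whose 12 is absorbed by the summand 1 in [mesh_choice]. *)
pose D := 24 * c0 + 7254.
have D0 : 0 <= B * D.
  by apply: mulr_ge0; [apply: le_trans B1; apply: ler01 | rewrite /D; clear -c00; lra].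
have [n [M [M1 hn hD]]] := mesh_choice D0 e0.
have M0 : 0 < M by apply: lt_le_trans M1.
(* The mesh: dividing by [h] carries [K], of radius at most [B], into the disc of radius [M]. *)
pose h := B / M.
have h0 : 0 < h by rewrite divr_gt0 //; apply: lt_le_trans B1.
have n0 : (0 < n)%N by rewrite -(ltr0n R); lra.
set hc : C := ((h%:C)%C : C).
have nh : hc != 0 by rewrite -md_gt0 md_real gtr0_norm.
have [g hg] : exists g : nat -> nat -> C -> C, forall i j, poly_approx K (g i j) /\
    forall z, K z -> md (hc * g i j z - kern (z / hc - node R n i j))
      <= c0 / (1 + md (z / hc - node R n i j) ^+ 2).
  have H (i j : nat) : exists f, poly_approx K f /\ forall z, K z ->
    md (hc * f z - kern (z / hc - node R n i j)) <= c0 / (1 + md (z / hc - node R n i j) ^+ 2).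
    have [f f1 f2] := hker (hc * node R n i j) h h0; exists f; split => // z Kz.
    by have -> : z / hc - node R n i j = (z - hc * node R n i j) / hc by [field]; apply: f2.
  exists (fun i j => projT1 (cid (H i j))) => i j.
  by case: cid.
have /andP[l2 l6] := lcoef_bounds R n0.
set l : C := (((lcoef R n)%:C)%C : C).
have l0 : 0 < lcoef R n by apply: lt_le_trans l2.
have nl : l != 0 by rewrite -md_gt0 md_real gtr0_norm.
pose F z := hc / l * \sum_(0 <= i < (2 * n).+1) \sum_(0 <= j < (2 * n).+1) (hc * g i j z).
exists F.
  apply: poly_approxM => //; first exact: poly_approx_cst.
  do 2 (apply: poly_approx_sum => ?); apply: poly_approxM => //; first exact: poly_approx_cst.
  exact: (hg _ _).1.
move=> z Kz.
have hconj : z^* = hc / l * (l * (z / hc)^*).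
  have hcc : hc^* = hc by rewrite conjE /hc /= oppr0.
  by rewrite rmorphM fmorphV /= hcc; field; rewrite nl nh.
pose S := \sum_(0 <= i < (2 * n).+1) \sum_(0 <= j < (2 * n).+1)
  (hc * g i j z - kern (z / hc - node R n i j)).
have -> : z^* - F z = - (hc / l) * (S + latt_err n (z / hc)).
  have -> : S = \sum_(0 <= i < (2 * n).+1) \sum_(0 <= j < (2 * n).+1) (hc * g i j z) - latt n (z / hc).
    by rewrite /S /latt -sumrB; apply: eq_bigr => i _; rewrite -sumrB.
  by rewrite /F {1}hconj /latt_err -/l; ring.
have hS : md S <= c0 * (24 * Num.sqrt (2 * n).+1%:R).
  apply: le_trans (ler_wpM2l c00 (node_sum n (z / hc))).
  rewrite /S; apply: le_trans (md_sum _ _) _.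
  rewrite mulr_sumr; apply: ler_sum => i _; apply: le_trans (md_sum _ _) _.
  rewrite mulr_sumr; apply: ler_sum => j _; exact: (hg i j).2.
have hz : md (z / hc) <= M.
  rewrite md_div md_real gtr0_norm // /h invf_div mulrA ler_pdivrMr ?(lt_le_trans _ B1) //.
  by rewrite mulrC ler_pM2l // hB.
have hE := latt_approx M1 hn hz.
rewrite mdM mdN md_div !md_real !gtr0_norm //.
have hT : md (S + latt_err n (z / hc)) <= D * (Num.sqrt (2 * n).+1%:R + 1 + M ^+ 2 / n%:R).
  apply: le_trans (mdD _ _) _; apply: le_trans (lerD hS hE) _.
  have s0 : 0 <= Num.sqrt (2 * n).+1%:R :> R by apply: sqrtr_ge0.
  have q0 : 0 <= M ^+ 2 / n%:R by rewrite divr_ge0 // exprn_ge0 // ltW.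
  rewrite -mulrA /D; move: (Num.sqrt _) (M ^+ 2 / _) s0 q0 => x y x0 y0.
  by clear -c00 x0 y0; nra.
have hl : h / lcoef R n <= h.
  by rewrite ler_pdivrMr // ler_peMr ?(ltW h0) //; apply: le_trans l2; rewrite ler1n.
apply: le_trans (ler_pM _ (md_ge0 _) hl hT) _; first by rewrite divr_ge0 ?ltW.
by rewrite /h mulrAC ler_pdivrMr // mulrA.
Qed.

Lemma cplx_ball (w z : C) (e : C) : ball w e z = (`|w - z| < e).
Proof. by []. Qed.

Lemma open_md (U : set C) : (forall w, U w -> exists2 d : R, 0 < d & forall w', md (w' - w) < d -> U w') ->
  open U.
Proof.
move=> h; rewrite openE => w /h[d d0 hd]; apply/nbhs_ballP.
exists ((d%:C)%C : C) => /=; first by rewrite ltcR.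
by move=> z; rewrite cplx_ball -mdE ltcR mdB => /hd.
Qed.

Lemma open_mdP (U : set C) w : open U -> U w -> exists2 d : R, 0 < d & forall w', md (w' - w) < d -> U w'.
Proof.
rewrite openE => h /h /nbhs_ballP[e /= e0 he].
have ee : ((complex.Re e)%:C)%C = e by apply: RRe_real; apply: gtr0_real.
have r0 : 0 < complex.Re e by rewrite -ltcR ee.
exists (complex.Re e) => // z hz; apply: he; rewrite cplx_ball -mdE -ee ltcR mdB.
exact: hz.
Qed.

Lemma Lavrentieff_poly_approx_conj (K : set C) : Lavrentieff K -> poly_approx K (fun z => z^*).
Proof.
move=> [Kc Kconn Kint].
have Kclosed : closed K by apply: compact_closed => //; exact: norm_hausdorff.
have Kbd : exists B : R, forall z, K z -> md z <= B.
  have hcov : K `<=` cover [set: nat] (fun n => [set z : C | md z < n%:R]).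
    move=> z _; exists (Num.truncn (md z)).+1 => //=; exact: truncnS_gt.
  move: Kc; rewrite compact_cover => /(_ _ _ _ _ hcov)[i _|D' _ hD'].
    apply: open_md => z /= hz; exists (i%:R - md z) => [|z']; first by rewrite subr_gt0.
    by have := md_ge_sub z' z; lra.
  exists (\max_(i <- D') i)%:R => z /hD'[i /= hi hz].
  apply: ltW; apply: lt_le_trans hz _; rewrite ler_nat; exact: leq_bigmax_seq.
have oK : open (~` K) by apply: closed_openC.
apply: poly_approx_conj => //; apply: kernel_approx => //.
- move=> w nK; have [d d0 hd] := open_mdP oK nK.
  by exists d => // z Kz; rewrite leNgt; apply/negP => /hd.
- move=> w r r0; have [[a [h1 h2]]|none] := pselect (exists a, ~ K a /\ md (a - w) <= r); first by exists a.
  have : interior K w.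
    apply/nbhs_ballP; exists ((r%:C)%C : C) => /=; first by rewrite ltcR.
    move=> z; rewrite cplx_ball -mdE ltcR mdB => hz.
    by apply: contrapT => nK; apply: none; exists z; split => //; apply: ltW.
  by rewrite Kint.
- move=> U [w0 Uw0] UK U1 U2 w nKw.
  suff -> : U = ~` K by [].
  apply: Kconn; first by exists w0.
    by exists U; [apply: open_md | rewrite setIC; apply/esym/setIidl => x /UK].
  exists (~` (~` K `&` ~` U)).
    apply: open_closedC; apply: open_md => x [nK nU].
    have [d d0 hd] := U2 _ nK nU; have [d' d0' hd'] := open_mdP oK nK.
    exists (Num.min d d') => [|y]; first by rewrite lt_min d0.
    by rewrite lt_min => /andP[/hd ? /hd' ?].
  apply/seteqP; split => x /=.
    by move=> Ux; split; [apply: UK | move=> []].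
  by move=> [nK h]; apply: contrapT => nU; apply: h.
Qed.

End ConjugateApprox.

(** * Multiplicative seminorms on complex polynomials *)

Section MultiplicativeSeminorm.
Variable R : realType.
Local Notation C := (cplx R).

Lemma exprn_upper_continuous (m e : R) (n : nat) : 0 < m -> 0 < e ->
  exists2 d : R, 0 < d & (m + d) ^+ n <= m ^+ n + e.
Proof.
move=> m0; elim: n e => [|n IH] e e0; first by exists 1; rewrite ?expr0 //; lra.
have e1 : 0 < e / (2 * (m + 1)) by rewrite divr_gt0 //; lra.
have [d d0 hd] := IH _ e1.
have mn : 0 < m ^+ n by apply: exprn_gt0.
pose d' := Num.min d (Num.min 1 (e / (2 * m ^+ n))).
have d'0 : 0 < d' by rewrite /d' !lt_min d0 ltr01 divr_gt0 // mulr_gt0.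
have d'd : d' <= d by rewrite /d' ge_min lexx.
have d'1 : d' <= 1 by rewrite /d' !ge_min lexx orbT.
have d'e : d' * (2 * m ^+ n) <= e.
  by rewrite -ler_pdivlMr ?mulr_gt0 // /d' !ge_min lexx !orbT.
exists d' => //; rewrite !exprSr.
have h1 : (m + d') ^+ n <= m ^+ n + e / (2 * (m + 1)).
  by apply: le_trans hd; apply: lerXn2r; rewrite ?nnegrE; lra.
have h2 : e / (2 * (m + 1)) * (m + 1) = e / 2 by field; lra.
have h3 : (m + d') ^+ n * (m + d') <= (m ^+ n + e / (2 * (m + 1))) * (m + d').
  by apply: ler_wpM2r => //; lra.
have h4 : e / (2 * (m + 1)) * (m + d') <= e / (2 * (m + 1)) * (m + 1).
  by apply: ler_wpM2l; lra.
by lra.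
Qed.

(* Ostrowski's argument: if m is the infimum of P ('X - c) over c and m > 0, factoring
   x ^ n - d ^ n shows that P is also almost minimal at distance m / 2 from an almost
   minimal point, hence arbitrarily far away, which is absurd. *)
Lemma mult_seminorm_root (P : {poly C} -> R) :
  (forall p q, P (p + q) <= P p + P q) -> (forall p q, P (p * q) = P p * P q) ->
  (forall c, P c%:P = md c) -> exists mu : C, P ('X - mu%:P) = 0.
Proof.
move=> PD PM PC.
have P0 q : 0 <= P q.
  have P00 : P 0 = 0 by rewrite (PC 0) md0.
  have PN : P (- q) = P q by rewrite -mulN1r PM -polyCN PC mdN md1 mul1r.
  by have := PD q (- q); rewrite subrr P00 PN; lra.
have PX q j : P (q ^+ j) = P q ^+ j.
  by elim: j => [|j IH]; [rewrite !expr0 (PC 1) md1 | rewrite !exprS PM IH].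
pose f c := P ('X - c%:P).
pose E := [set f c | c in [set: C]].
have hE : has_inf E by split; [exists (f 0); exists 0 | exists 0 => _ [c _ <-]; apply: P0].
pose m := inf E.
have mf c : m <= f c by apply: ge_inf; [exact: hE.2 | exists c].
have mE e : 0 < e -> exists c, f c < m + e.
  by move=> e0; have [_ [c _ <-] h] := inf_adherent e0 hE; exists c.
have [m0|m0] := leP m 0; last first.
  exfalso.
  (* Powers of two keep the factorization to repeated differences of squares, down to linear
     factors, each of seminorm at least [m]. [low2] keeps the factor ['X - (c + d)] apart and bounds
     only the others. *)
  have low k c e : m ^+ (2 ^ k) <= P (('X - c%:P) ^+ (2 ^ k) - e%:P).
    elim: k e => [|k IH] e.
      rewrite expn0 !expr1; have -> : 'X - c%:P - e%:P = 'X - (c + e)%:P by rewrite polyCD; ring.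
      exact: mf.
    have -> : ('X - c%:P) ^+ (2 ^ k.+1) - e%:P = (('X - c%:P) ^+ (2 ^ k) - (sqrtC e)%:P) *
        (('X - c%:P) ^+ (2 ^ k) - (- sqrtC e)%:P).
      rewrite expnSr exprM -{1}(sqrtCK e) rmorphXn rmorphN /=; ring.
    by rewrite PM expnSr exprM expr2; apply: ler_pM => //; apply: exprn_ge0; apply: ltW.
  have low2 k c d : f (c + d) * m ^+ (2 ^ k) <= m * P (('X - c%:P) ^+ (2 ^ k) - (d ^+ (2 ^ k))%:P).
    elim: k => [|k IH].
      rewrite expn0 !expr1 mulrC; have -> : 'X - c%:P - d%:P = 'X - (c + d)%:P by rewrite polyCD; ring.
      by [].
    have -> : ('X - c%:P) ^+ (2 ^ k.+1) - (d ^+ (2 ^ k.+1))%:P =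
       (('X - c%:P) ^+ (2 ^ k) - (d ^+ (2 ^ k))%:P) * (('X - c%:P) ^+ (2 ^ k) - (- d ^+ (2 ^ k))%:P).
      rewrite expnSr !exprM rmorphXn rmorphN /=; ring.
    rewrite PM mulrA expnSr exprM (expr2 (m ^+ _)) mulrA.
    by apply: ler_pM => //; [apply: mulr_ge0; [apply: P0 |] |]; apply: exprn_ge0; apply: ltW.
  (* The power [d ^ n] then costs only [(m / 2) ^ n], negligible against [m ^ n] for large [n]. *)
  pose d : C := (((m / 2)%:C)%C : C).
  have mdd : md d = m / 2 by rewrite md_real gtr0_norm //; lra.
  have step1 e : 0 < e -> exists2 t : R, 0 < t & forall c, f c <= m + t -> f (c + d) <= m + e.
    move=> e0.
    have [k hk] : exists k, m * 2^-1 ^+ k <= e / 2 by apply: geometric_le; apply: divr_gt0.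
    set n := (2 ^ k)%N.
    have mn : 0 < m ^+ n by apply: exprn_gt0.
    have e1 : 0 < m ^+ n * (e / 2) / m by rewrite divr_gt0 // mulr_gt0 //; lra.
    have [t t0 ht] := exprn_upper_continuous n m0 e1; exists t => // c hc.
    have h1 := low2 k c d; rewrite -/n in h1.
    have h2 : P (('X - c%:P) ^+ n - (d ^+ n)%:P) <= m ^+ n + m ^+ n * (e / 2) / m + (m / 2) ^+ n.
      apply: le_trans (PD _ _) _; apply: lerD.
        apply: le_trans ht.
        by rewrite PX -/(f c); apply: lerXn2r; rewrite ?nnegrE ?P0 //; lra.
      by rewrite -polyCN PC mdN mdX mdd.
    have hn : 2^-1 ^+ n <= 2^-1 ^+ k :> R.
      by apply: ler_wiXn2l; rewrite ?invr_ge0 ?invf_le1 ?ler1n // /n ltnW // ltn_expl.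
    have h3 : m * (m ^+ n + m ^+ n * (e / 2) / m + (m / 2) ^+ n) <= (m + e) * m ^+ n.
      have -> : m * (m ^+ n + m ^+ n * (e / 2) / m + (m / 2) ^+ n) =
         (m + e / 2 + m * 2^-1 ^+ n) * m ^+ n by rewrite exprMn; field; lra.
      have : m * 2^-1 ^+ n <= m * 2^-1 ^+ k by rewrite ler_pM2l.
      by move=> h; rewrite ler_pM2r //; lra.
    have : f (c + d) * m ^+ n <= (m + e) * m ^+ n.
      by apply: le_trans h1 (le_trans _ h3); rewrite ler_pM2l.
    by rewrite ler_pM2r.
  have stepJ J e : 0 < e -> exists2 t : R, 0 < t & forall c, f c <= m + t -> f (c + d *+ J) <= m + e.
    elim: J e => [|J IH] e e0; first by exists e => // c; rewrite mulr0n addr0.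
    have [t t0 ht] := step1 _ e0; have [t' t'0 ht'] := IH _ t0.
    by exists t' => // c /ht' /ht; rewrite -addrA -mulrSr.
  pose J := (Num.truncn (2 * (m + 1 + m + 1) / m)).+1.
  have hJ : 2 * (m + 1 + m + 1) < J%:R * m by rewrite -ltr_pdivrMr //; exact: truncnS_gt.
  have [t t0 ht] := stepJ J 1 ltr01.
  have mt : 0 < Num.min t 1 by rewrite lt_min t0 ltr01.
  have [c hc] := mE _ mt.
  have [hc1 hc2] : f c <= m + t /\ f c <= m + 1.
    have a1 : Num.min t 1 <= t by rewrite ge_min lexx.
    have a2 : Num.min t 1 <= 1 by rewrite ge_min lexx orbT.
    by split; lra.
  have h1 := ht c hc1.
  have h2 : md (d *+ J) <= f c + f (c + d *+ J).
    rewrite -PC; have -> : (d *+ J)%:P = ('X - c%:P) + (- 1)%:P * ('X - (c + d *+ J)%:P).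
      by rewrite polyCD polyCN polyC1; ring.
    by apply: le_trans (PD _ _) _; rewrite PM PC mdN md1 mul1r.
  have h3 : md (d *+ J) = m / 2 * J%:R by rewrite -(mulr_natr d) mdM mdd md_nat.
  by move: h2; rewrite h3; move: (J%:R : R) hJ => j hJ; lra.
(* The infimum is now at most 0, and points with small [f] are close to each other. Their common
   limit is found coordinatewise, as the supremum of [g c - f c] for [g] the real or imaginary
   part. *)
have fsep c c' : md (c - c') <= f c + f c'.
  rewrite -PC; have -> : (c - c')%:P = (- 1)%:P * ('X - c%:P) + ('X - c'%:P).
    by rewrite !polyCD !polyCN polyC1; ring.
  by apply: le_trans (PD _ _) _; rewrite PM PC mdN md1 mul1r.
have coord (g : C -> R) : (forall c c', g c - g c' <= md (c - c')) ->
    exists a, forall c, `|a - g c| <= f c.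
  move=> hg; pose G := [set g c - f c | c in [set: C]].
  have ub c : forall y, G y -> y <= g c + f c.
    by move=> _ [c' _ <-]; have := hg c' c; have := fsep c' c; lra.
  have hG : has_sup G by split; [exists (g 0 - f 0); exists 0 | exists (g 0 + f 0); apply: ub].
  exists (sup G) => c; rewrite ler_norml; apply/andP; split.
    rewrite lerBrDl; apply: sup_upper_bound => //; by exists c.
  by rewrite lerBlDl; apply: ge_sup; [exact: hG.1 | exact: ub].
have [a ha] : exists a, forall c, `|a - complex.Re c| <= f c.
  apply: coord => c c'; rewrite -ReN -ReD; apply: le_trans (Re_le_md _); exact: ler_norm.
have [b hb] : exists b, forall c, `|b - complex.Im c| <= f c.
  apply: coord => c c'; rewrite -ImN -ImD; apply: le_trans (Im_le_md _); exact: ler_norm.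
pose mu : C := Complex a b; exists mu.
apply/eqP; rewrite eq_le P0 andbT; apply/ler_addgt0Pr => e e0; rewrite add0r.
have e3 : 0 < e / 3 by lra.
have [c hc] := mE _ e3.
have -> : 'X - mu%:P = ('X - c%:P) + (c - mu)%:P by rewrite polyCD polyCN; ring.
apply: le_trans (PD _ _) _; rewrite PC mdB.
have := md_le_ReIm (mu - c); rewrite ReD ImD ReN ImN /=.
have := ha c; have := hb c; rewrite -/(f c); lra.
Qed.

End MultiplicativeSeminorm.

(** * C*-seminorms and points of the spectrum *)

Section CstarAlgebra.
Variables (R : realType).
Local Notation C := (cplx R).
Variables (A : algType C) (star : A -> A) (nrm : A -> R).
Hypothesis HA : is_unital_Cstar_algebra star nrm.
Implicit Types (x y z : A) (c : C).

Lemma nrm_ge0 x : 0 <= nrm x. Proof. by case: HA => -[]. Qed.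

Lemma nrm_eq0 x : nrm x = 0 -> x = 0. Proof. by case: HA => -[_ h]; auto. Qed.

Lemma nrmD x y : nrm (x + y) <= nrm x + nrm y. Proof. by case: HA => -[]. Qed.

Lemma nrmM x y : nrm (x * y) <= nrm x * nrm y. Proof. by case: HA => -[]. Qed.

Lemma nrmZ c x : nrm (c *: x) = md c * nrm x.
Proof.
by case: HA => -[_ _ _ h _] _ _; apply: (@complexI R); rewrite rmorphM /= mdE h.
Qed.

Lemma nrmN x : nrm (- x) = nrm x.
Proof. by rewrite -scaleN1r nrmZ mdN md1 mul1r. Qed.

Lemma nrm_triangle y x z : nrm (x - z) <= nrm (x - y) + nrm (y - z).
Proof. by apply: le_trans (nrmD _ _); rewrite addrA subrK. Qed.

Lemma starD x y : star (x + y) = star x + star y. Proof. by case: HA => _ _ []. Qed.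

Lemma starZ c x : star (c *: x) = c^* *: star x. Proof. by case: HA => _ _ []. Qed.

Lemma starM x y : star (x * y) = star y * star x. Proof. by case: HA => _ _ []. Qed.

Lemma starK x : star (star x) = x. Proof. by case: HA => _ _ []. Qed.

Lemma nrm_sq x : nrm (star x * x) = nrm x ^+ 2. Proof. by case: HA => _ _ []. Qed.

Lemma star1 : star 1 = 1.
Proof. by have := starM (star 1) 1; rewrite mulr1 starK mulr1. Qed.

Lemma star_scalar c : star c%:A = (c^*)%:A.
Proof. by rewrite starZ star1. Qed.

Lemma starN x : star (- x) = - star x.
Proof. by rewrite -scaleN1r starZ rmorphN1 scaleN1r. Qed.

Lemma starX x n : star (x ^+ n) = star x ^+ n.
Proof. by elim: n => [|n IH]; rewrite ?expr0 ?star1 // exprS starM IH exprSr. Qed.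

Lemma nrm1 : nrm 1 = 1.
Proof.
have := nrm_sq 1; rewrite star1 mulr1 expr2 => h.
have n0 : nrm 1 != 0 by apply/eqP => /nrm_eq0 /eqP; rewrite oner_eq0.
by apply: (mulfI n0); rewrite -h mulr1.
Qed.

Lemma nrm_scalar c : nrm c%:A = md c. Proof. by rewrite nrmZ nrm1 mulr1. Qed.

Section Normal.
Variable N : A.
Hypothesis HN : normal_elt star N.

(** By normality of [N] this is a commutative star-subalgebra containing [N]. It is also closed
    under inverses, so non-invertibility in it is non-invertibility in the whole algebra. *)
Definition bicommutant x : Prop :=
  forall z, z * N = N * z -> z * star N = star N * z -> x * z = z * x.
Local Notation S := bicommutant.

Lemma bicommutantN : S N. Proof. by move=> z hz _. Qed.
Lemma bicommutantA c : S c%:A.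
Proof. by move=> z _ _; rewrite -scalerAl -scalerAr mul1r mulr1. Qed.
Lemma bicommutant1 : S 1. Proof. by move=> z _ _; rewrite mul1r mulr1. Qed.
Lemma bicommutantD x y : S x -> S y -> S (x + y).
Proof. by move=> hx hy z h1 h2; rewrite mulrDl mulrDr hx // hy. Qed.
Lemma bicommutantM x y : S x -> S y -> S (x * y).
Proof. by move=> hx hy z h1 h2; rewrite -mulrA hy // mulrA hx // mulrA. Qed.
Lemma bicommutantZ c x : S x -> S (c *: x).
Proof. by move=> hx z h1 h2; rewrite -scalerAl -scalerAr hx. Qed.
Lemma bicommutantB x y : S x -> S y -> S (x - y).
Proof. by move=> hx hy; apply: bicommutantD => //; rewrite -scaleN1r; apply: bicommutantZ. Qed.
Lemma bicommutantX x n : S x -> S (x ^+ n).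
Proof.
move=> hx; elim: n => [|n IH]; first exact: bicommutant1.
by rewrite exprS; apply: bicommutantM.
Qed.
Lemma bicommutant_star x : S x -> S (star x).
Proof.
move=> hx z h1 h2; rewrite -[z]starK -!starM; congr star; symmetry; apply: hx.
  by rewrite -[N]starK -!starM h2.
by rewrite -!starM h1.
Qed.
Lemma bicommutant_comm x y : S x -> S y -> x * y = y * x.
Proof. by move=> hx hy; apply: hx; apply: hy. Qed.
Lemma bicommutant_inv x y : S x -> x * y = 1 -> y * x = 1 -> S y.
Proof.
move=> hx h1 h2 z z1 z2; rewrite -[z in LHS]mulr1 -h1 (mulrA z) -(hx z z1 z2).
by rewrite !mulrA h2 mul1r.
Qed.
Lemma bicommutant_poly (q : {poly C}) : S (horner_alg N q).
Proof.
elim/poly_ind: q => [|q c IH]; first by rewrite rmorph0 -[0](scale0r 1); apply: bicommutantA.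
rewrite rmorphD rmorphM /= horner_algC horner_algX.
by apply: bicommutantD; [apply: bicommutantM => //; apply: bicommutantN | apply: bicommutantA].
Qed.

(** Only inequalities that pass to infima are recorded; the equalities follow in [semi1], [semiA],
    [semi_star] and [semi_sqE]. *)
Record cstar_seminorm (p : A -> R) : Prop := CstarSeminorm {
  semi_ge0 : forall x, S x -> 0 <= p x;
  semi_D : forall x y, S x -> S y -> p (x + y) <= p x + p y;
  semi_Z : forall c x, S x -> p (c *: x) <= md c * p x;
  semi_M : forall x y, S x -> S y -> p (x * y) <= p x * p y;
  semi_sq : forall x, S x -> p x ^+ 2 <= p (star x * x);
  semi_1 : 1 <= p 1 }.

Lemma cstar_seminorm_nrm : cstar_seminorm nrm.
Proof.
split=> *; rewrite ?nrm_ge0 ?nrmD ?nrmZ ?nrmM ?nrm_sq ?nrm1 //.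
Qed.

Section SeminormTheory.
Variable p : A -> R.
Hypothesis hp : cstar_seminorm p.

Lemma semi1 : p 1 = 1.
Proof.
have := semi_sq hp bicommutant1; rewrite star1 mulr1 expr2 => h.
by apply/eqP; rewrite eq_le semi_1 // andbT; have := semi_1 hp; nra.
Qed.

Lemma semiA c : p c%:A = md c.
Proof.
have le d : p d%:A <= md d by have := semi_Z hp d bicommutant1; rewrite semi1 mulr1.
apply/eqP; rewrite eq_le le /=.
have [->|c0] := eqVneq c 0; first by rewrite md0; apply: semi_ge0 (bicommutantA _).
have mc : 0 < md c by rewrite md_gt0.
have := semi_Z hp c^-1 (bicommutantA c); rewrite scalerA mulVf // scale1r semi1 mdV.
by rewrite mulrC ler_pdivlMr // mul1r.
Qed.

Lemma semi_star x : S x -> p (star x) = p x.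
Proof.
have le y : S y -> p y <= p (star y).
  move=> hy; have hsy := bicommutant_star hy.
  have := le_trans (semi_sq hp hy) (semi_M hp hsy hy).
  have := semi_ge0 hp hy; have := semi_ge0 hp hsy.
  rewrite expr2 => h1 h2; have [->|b0] := eqVneq (p y) 0; first by [].
  by rewrite ler_pM2r // lt_neqAle eq_sym b0.
by move=> hx; apply/eqP; rewrite eq_le le // andbT -{2}(starK x); apply: le; apply: bicommutant_star.
Qed.

Lemma semi_sqE x : S x -> p (star x * x) = p x ^+ 2.
Proof.
move=> hx; apply/eqP; rewrite eq_le (semi_sq hp hx) andbT.
by apply: le_trans (semi_M hp (bicommutant_star hx) hx) _; rewrite semi_star // expr2.
Qed.

End SeminormTheory.

(** Directedness makes sums and products survive the infimum. The product and star conditions may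
    pass to another member of [F], because the functions used in localization need not be
    C*-seminorms individually; Zorn chains are the other use. *)
Lemma cstar_seminorm_inf (F : set (A -> R)) : F !=set0 ->
  (forall p, F p -> forall x, S x -> 0 <= p x) ->
  (forall p, F p -> forall x y, S x -> S y -> p (x + y) <= p x + p y) ->
  (forall p, F p -> forall c x, S x -> p (c *: x) <= md c * p x) ->
  (forall p q, F p -> F q -> exists2 r, F r & forall x, S x -> r x <= p x /\ r x <= q x) ->
  (forall p, F p -> exists2 q, F q & forall x y, S x -> S y -> q (x * y) <= p x * p y) ->
  (forall p, F p -> exists2 q, F q & forall x, S x -> q x ^+ 2 <= p (star x * x)) ->
  (forall p, F p -> 1 <= p 1) ->
  exists q, [/\ cstar_seminorm q, forall p, F p -> forall x, S x -> q x <= p x &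
    forall x m, S x -> (forall p, F p -> m <= p x) -> m <= q x].
Proof.
move=> [p0 Fp0] F0 FD FZ Fdir FM Fsq F1.
pose q x := inf [set p x | p in F].
have hlb x : S x -> has_inf [set p x | p in F].
  by move=> Sx; split; [exists (p0 x), p0 | exists 0 => _ [p Fp <-]; apply: F0].
have qle p : F p -> forall x, S x -> q x <= p x.
  by move=> Fp x Sx; apply: ge_inf; [exact: (hlb _ Sx).2 | exists p].
have qge x m : S x -> (forall p, F p -> m <= p x) -> m <= q x.
  by move=> Sx hm; apply: lb_le_inf; [exact: (hlb _ Sx).1 | move=> _ [p Fp <-]; apply: hm].
have qadh x e : S x -> 0 < e -> exists2 p, F p & p x < q x + e.
  by move=> Sx e0; have [_ [p Fp <-] h] := inf_adherent e0 (hlb _ Sx); exists p.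
have q0 x : S x -> 0 <= q x by move=> Sx; apply: qge => // p Fp; apply: F0.
have qadh2 x y e : S x -> S y -> 0 < e ->
    exists2 p, F p & p x < q x + e /\ p y < q y + e.
  move=> Sx Sy e0; have [p1 F1' h1] := qadh x e Sx e0; have [p2 F2' h2] := qadh y e Sy e0.
  have [r Fr hr] := Fdir _ _ F1' F2'; exists r => //.
  by have [] := hr x Sx; have [] := hr y Sy; split; lra.
exists q; split => //; split => //.
- move=> x y Sx Sy; apply/ler_addgt0Pr => e e0; have e2 : 0 < e / 2 by lra.
  have [p Fp [h1 h2]] := qadh2 x y _ Sx Sy e2.
  apply: le_trans (qle _ Fp _ (bicommutantD Sx Sy)) _.
  by have := FD _ Fp x y Sx Sy; lra.
- have qz c x : S x -> q (c *: x) <= md c * q x.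
    move=> Sx; apply/ler_addgt0Pr => e e0.
    have mc := md_ge0 c; have mc1 : 0 < md c + 1 by lra.
    have e1 : 0 < e / (md c + 1) by rewrite divr_gt0.
    have [p Fp h] := qadh x _ Sx e1.
    apply: le_trans (qle _ Fp _ (bicommutantZ c Sx)) _; apply: le_trans (FZ _ Fp c x Sx) _.
    have h2 : md c * p x <= md c * (q x + e / (md c + 1)) by apply: ler_wpM2l => //; apply: ltW.
    have h3 : e / (md c + 1) * (md c + 1) = e by rewrite divfK //; lra.
    by lra.
  exact: qz.
- move=> x y Sx Sy; apply/ler_addgt0Pr => e e0.
  have x0 := q0 x Sx; have y0 := q0 y Sy.
  have s0 : 0 < q x + q y + 1 by lra.
  pose d := Num.min 1 (e / (q x + q y + 1)).
  have d0 : 0 < d by rewrite lt_min ltr01 divr_gt0.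
  have d1 : d <= 1 by rewrite ge_min lexx.
  have de : d * (q x + q y + 1) <= e by rewrite -ler_pdivlMr // ge_min lexx orbT.
  have [p Fp [h1 h2]] := qadh2 x y _ Sx Sy d0.
  have [r Fr hr] := FM _ Fp.
  apply: le_trans (qle _ Fr _ (bicommutantM Sx Sy)) _; apply: le_trans (hr _ _ Sx Sy) _.
  have : p x * p y <= (q x + d) * (q y + d) by apply: ler_pM; rewrite ?F0 // ltW.
  by move: d d0 d1 de h1 h2 => d d0 d1 de _ _; nra.
- move=> x Sx; apply: qge => [|p Fp].
    by apply: bicommutantM => //; apply: bicommutant_star.
  have [r Fr hr] := Fsq _ Fp; apply: le_trans (hr x Sx).
  by apply: lerXn2r; rewrite ?nnegrE ?q0 ?(F0 _ Fr) // qle.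
- by apply: qge => //; apply: bicommutant1.
Qed.

(* q x is the limit of p (x (f^* f)^n) / p f ^ (2 n): it sees only the part of the spectrum
   where |f| is maximal. *)
Lemma cstar_seminorm_localize p f : cstar_seminorm p -> S f -> 0 < p f ->
  exists q, [/\ cstar_seminorm q, forall x, S x -> q x <= p x,
    forall x, S x -> q (x * f) = q x * p f &
    forall t r, S t -> 0 < r -> (forall x, S x -> p (x * t) = p x * r) ->
      forall x, S x -> q (x * t) = q x * r].
Proof.
move=> hp Sf f0; pose g := star f * f; pose rho := p f ^+ 2.
have Ssf := bicommutant_star Sf; have Sg : S g by apply: bicommutantM.
have Sgn n : S (g ^+ n) by apply: bicommutantX.
have sg n : star (g ^+ n) = g ^+ n by rewrite starX /g starM starK.
have r0 : 0 < rho by apply: exprn_gt0.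
have rn n : 0 < rho ^+ n by apply: exprn_gt0.
have pg : p g = rho by apply: semi_sqE.
have pgle n : p (g ^+ n) <= rho ^+ n.
  elim: n => [|n IH]; first by rewrite !expr0 semi1.
  by rewrite !exprS; apply: le_trans (semi_M hp Sg (Sgn n)) _; rewrite pg ler_pM2l.
(* Log-convexity: [p (g ^ (n + 1)) ^ 2 <= p (g ^ (n + 2)) * p (g ^ n)], so the induction carries two
   consecutive powers. *)
have pgge n : rho ^+ n <= p (g ^+ n).
  suff [] : rho ^+ n <= p (g ^+ n) /\ rho ^+ n.+1 <= p (g ^+ n.+1) by [].
  elim: n => [|n [IH1 IH2]]; first by rewrite !expr0 !expr1 semi1 // pg.
  split => //.
  have h := semi_sq hp (Sgn n.+1); rewrite sg in h.
  have e : g ^+ n.+1 * g ^+ n.+1 = g ^+ n.+2 * g ^+ n by rewrite -!exprD; congr (_ ^+ _); lia.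
  rewrite e in h; have h2 := le_trans h (semi_M hp (Sgn _) (Sgn _)).
  have h3 : rho ^+ n.+1 * rho ^+ n.+1 <= p (g ^+ n.+1) ^+ 2.
    by rewrite expr2; apply: ler_pM => //; apply: ltW.
  have h4 : p (g ^+ n.+2) * p (g ^+ n) <= p (g ^+ n.+2) * rho ^+ n.
    by apply: ler_wpM2l => //; apply: semi_ge0.
  have h5 : rho ^+ n.+2 * rho ^+ n = rho ^+ n.+1 * rho ^+ n.+1.
    by rewrite -!exprD; congr (_ ^+ _); lia.
  by rewrite -(ler_pM2r (rn n)) h5; apply: le_trans h3 (le_trans h2 h4).
pose F := [set (fun x => p (x * g ^+ n) / rho ^+ n) | n in [set: nat]].
have Sx_ n x : S x -> S (x * g ^+ n) by move=> Sx; apply: bicommutantM.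
have dec n m x : S x -> p (x * g ^+ (n + m)) / rho ^+ (n + m) <= p (x * g ^+ n) / rho ^+ n.
  move=> Sx; rewrite ler_pdivrMr // mulrAC ler_pdivlMr //.
  rewrite exprD mulrA; apply: le_trans (ler_wpM2r (ltW (rn n)) (semi_M hp (Sx_ n x Sx) (Sgn m))) _.
  rewrite -mulrA exprD; apply: ler_wpM2l; first by apply: semi_ge0 => //; apply: Sx_.
  by rewrite mulrC ler_pM2l.
have [||||||||q [q1 q2 q3]] := @cstar_seminorm_inf F.
- by exists (fun x => p (x * g ^+ 0) / rho ^+ 0); exists 0%N.
- by move=> _ [n _ <-] x Sx; rewrite divr_ge0 // ?(ltW (rn n)) // semi_ge0 //; apply: Sx_.
- move=> _ [n _ <-] x y Sx Sy /=; rewrite (mulrDl x) -(mulrDl (p _)) ler_pM2r ?invr_gt0 //.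
  by apply: semi_D => //; apply: Sx_.
- move=> _ [n _ <-] c x Sx /=; rewrite mulrA ler_pM2r ?invr_gt0 // -scalerAl.
  by apply: semi_Z => //; apply: Sx_.
- move=> _ _ [n _ <-] [m _ <-]; exists (fun x => p (x * g ^+ (n + m)) / rho ^+ (n + m)).
    by exists (n + m)%N.
  by move=> x Sx; split; [apply: dec | rewrite addnC; apply: dec].
- move=> _ [n _ <-]; exists (fun x => p (x * g ^+ (n + n)) / rho ^+ (n + n)).
    by exists (n + n)%N.
  move=> x y Sx Sy /=; rewrite mulrACA -invfM -exprD ler_pM2r ?invr_gt0 //.
  have -> : x * y * g ^+ (n + n) = x * g ^+ n * (y * g ^+ n).
    by rewrite exprD !mulrA -!(mulrA x) (bicommutant_comm Sy (Sgn n)).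
  by apply: semi_M => //; apply: Sx_.
- move=> _ [n _ <-]; exists (fun x => p (x * g ^+ n) / rho ^+ n); first by exists n.
  move=> x Sx /=; have Ssx := bicommutant_star Sx.
  apply: le_trans (dec n n _ (bicommutantM Ssx Sx)).
  rewrite exprMn exprVn -exprM muln2 -addnn ler_pM2r ?invr_gt0 //.
  have -> : star x * x * g ^+ (n + n) = star (x * g ^+ n) * (x * g ^+ n).
    rewrite starM sg (bicommutant_comm (Sgn n) Ssx) exprD !mulrA -!(mulrA (star x)).
    by rewrite (bicommutant_comm Sx (Sgn n)).
  by apply: semi_sq => //; apply: Sx_.
- by move=> _ [n _ <-]; rewrite mul1r ler_pdivlMr // mul1r.
have qpn n x : S x -> q x <= p (x * g ^+ n) / rho ^+ n.
  by move=> Sx; apply: (q2 (fun y => p (y * g ^+ n) / rho ^+ n)) => //; exists n.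
have qp x : S x -> q x <= p x.
  by move=> Sx; have := qpn 0%N _ Sx; rewrite !expr0 mulr1 divr1.
exists q; split => //.
  move=> x Sx; apply/eqP; rewrite eq_le; apply/andP; split.
    apply: le_trans (semi_M q1 Sx Sf) _; apply: ler_wpM2l; last exact: qp.
    exact: semi_ge0.
  (* Multiplying by [g] shifts the sequence defining [q] by one index. The bound for [f] follows on
     splitting [g] into [f] and [star f]. *)
  have hg : q x * rho <= q (x * g).
    apply: q3; first exact: bicommutantM.
    move=> _ [n _ <-]; rewrite ler_pdivlMr // -(mulrA (q x)) -exprS -ler_pdivlMr //.
    have -> : x * g * g ^+ n = x * g ^+ n.+1 by rewrite exprS mulrA.
    exact: qpn.
  have hf : q (x * g) <= q (x * f) * p f.
    rewrite /g (bicommutant_comm Ssf Sf) mulrA.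
    apply: le_trans (semi_M q1 (bicommutantM Sx Sf) Ssf) _.
    apply: ler_wpM2l; first by apply: semi_ge0 => //; apply: bicommutantM.
    by rewrite -(semi_star hp Sf); apply: qp.
  by rewrite -(ler_pM2r f0) -(mulrA (q x)) -expr2; apply: le_trans hg hf.
move=> t r St rt0 ht x Sx.
have e n : p (x * t * g ^+ n) = p (x * g ^+ n) * r.
  by rewrite -mulrA (bicommutant_comm St (Sgn n)) mulrA ht //; apply: Sx_.
apply/eqP; rewrite eq_le; apply/andP; split; last first.
  apply: q3; first exact: bicommutantM.
  move=> _ [n _ <-]; rewrite e mulrAC; apply: ler_wpM2r; first exact: ltW.
  exact: qpn.
rewrite -ler_pdivrMr //; apply: q3 => // _ [n _ <-].
rewrite ler_pdivrMr // mulrAC -e.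
exact: (qpn _ _ (bicommutantM Sx St)).
Qed.

(* A minimal C*-seminorm among those for which T is multiplicative is multiplicative, since
   localizing it at any f does not change it. *)
Lemma character_seminorm T : S T -> 0 < nrm T -> exists p mu,
  [/\ cstar_seminorm p, forall x, S x -> p x <= nrm x, p T = nrm T & p (N - mu%:A) = 0].
Proof.
move=> ST T0.
(* Multiplicativity at [T] is required rather than [p T = nrm T]: localization preserves the former
   but may lower the value at [T]. The case [x = 1] returns the latter. *)
pose adm p := [/\ cstar_seminorm p, forall x, S x -> p x <= nrm x &
  forall x, S x -> p (x * T) = p x * nrm T].
have [p0 [p01 p02 p03 _]] := cstar_seminorm_localize cstar_seminorm_nrm ST T0.
pose Ty := {p | adm p}.
have t0 : Ty by exists p0.
(* The order is reversed, so that a maximal element is a minimal seminorm. *)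
pose below (a b : Ty) := `[< forall x, S x -> sval b x <= sval a x >].
have [| | |[p [p1 p2 p3]] pmin] := @ZL_preorder Ty t0 below.
- by move=> a; apply/asboolP.
- move=> a b c /asboolP h1 /asboolP h2; apply/asboolP => x Sx.
  exact: le_trans (h2 _ Sx) (h1 _ Sx).
- move=> Ch hCh; have [[a0 Ca0]|none] := pselect (Ch !=set0); last first.
    by exists t0 => a Ca; exfalso; apply: none; exists a.
  pose F := [set sval a | a in Ch].
  have hF p : F p -> adm p by move=> [a _ <-]; apply: (svalP a).
  have [||||||||q [q1 q2 q3]] := @cstar_seminorm_inf F.
  + by exists (sval a0), a0.
  + by move=> p /hF[hp _ _] x Sx; apply: (semi_ge0 hp).
  + by move=> p /hF[hp _ _] x y Sx Sy; apply: (semi_D hp).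
  + by move=> p /hF[hp _ _] c x Sx; apply: (semi_Z hp).
  + move=> _ _ [a Ca <-] [b Cb <-]; have [/asboolP h|/asboolP h] := hCh _ _ Ca Cb.
      by exists (sval b) => [|x Sx]; [exists b | split => //; apply: h].
    by exists (sval a) => [|x Sx]; [exists a | split => //; apply: h].
  + by move=> p Fp; exists p => // x y Sx Sy; have [hp _ _] := hF _ Fp; apply: (semi_M hp).
  + by move=> p Fp; exists p => // x Sx; have [hp _ _] := hF _ Fp; apply: (semi_sq hp).
  + by move=> p /hF[hp _ _]; apply: (semi_1 hp).
  have qadm : adm q.
    split => // [x Sx|x Sx].
      by have Fa : F (sval a0) by [exists a0]; apply: le_trans (q2 _ Fa _ Sx) _; have [_ + _] := hF _ Fa; apply.
    have SxT := bicommutantM Sx ST.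
    apply/eqP; rewrite eq_le; apply/andP; split.
      rewrite -ler_pdivrMr //; apply: q3 => // p Fp; rewrite ler_pdivrMr //.
      by have [_ _ <-] := hF _ Fp; rewrite ?q2.
    apply: q3 => // p Fp; have [_ _ ->] := hF _ Fp => //.
    by apply: ler_wpM2r; [apply: ltW | apply: q2].
  by exists (exist _ q qadm) => a Ca; apply/asboolP => x Sx /=; apply: q2 => //; exists a.
have pM x f : S x -> S f -> p (x * f) = p x * p f.
  move=> Sx Sf; have [f0|f0] := leP (p f) 0.
    have pf0 : p f = 0 by apply/eqP; rewrite eq_le f0 (semi_ge0 p1 Sf).
    apply/eqP; rewrite pf0 mulr0 eq_le (semi_ge0 p1 (bicommutantM Sx Sf)) andbT.
    by apply: le_trans (semi_M p1 Sx Sf) _; rewrite pf0 mulr0.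
  have [q [q1 q2 q3 q4]] := cstar_seminorm_localize p1 Sf f0.
  have qadm : adm q.
    by split => // [y Sy|]; [apply: le_trans (q2 _ Sy) (p2 _ Sy) | apply: q4].
  have le1 : below (exist _ p (And3 p1 p2 p3)) (exist _ q qadm) by apply/asboolP.
  have /asboolP /= le2 := pmin _ le1.
  have e y : S y -> p y = q y by move=> Sy; apply/eqP; rewrite eq_le le2 // q2.
  by rewrite !e //; [rewrite q3 // e | apply: bicommutantM].
pose P (q : {poly C}) := p (horner_alg N q).
have [||c|mu hmu] := @mult_seminorm_root R P.
- by move=> a b; rewrite /P rmorphD; apply: (semi_D p1); apply: bicommutant_poly.
- by move=> a b; rewrite /P rmorphM; apply: pM; apply: bicommutant_poly.
- by rewrite /P horner_algC semiA.
exists p, mu; split => //.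
  by have := p3 _ bicommutant1; rewrite mul1r semi1 // mul1r.
by move: hmu; rewrite /P rmorphB /= horner_algX horner_algC.
Qed.

(** An inverse of [N - mu] would lie in the bicommutant, and submultiplicativity would give
    [p 1 <= 0]. *)
Lemma seminorm_spectrum p mu : cstar_seminorm p -> p (N - mu%:A) = 0 -> spectrum N mu.
Proof.
move=> hp h0 [y [h1 h2]].
have Smu := bicommutantB bicommutantN (bicommutantA mu).
have := semi_M hp Smu (bicommutant_inv Smu h1 h2).
by rewrite h1 h0 mul0r semi1 // ler10.
Qed.

(** Take a seminorm attaining the norm of the difference and vanishing at [N - mu]. Modulo its
    kernel [N], [star N] and [horner_alg N q] are the scalars [mu], [mu^*] and [q.[mu]]. *)
Lemma nrm_star_sub_poly (q : {poly C}) (e : R) : 0 <= e ->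
  (forall c, spectrum N c -> md (c^* - q.[c]) <= e) -> nrm (star N - horner_alg N q) <= e.
Proof.
move=> e0 he; set T := star N - _.
have SsN := bicommutant_star bicommutantN.
have ST : S T by apply: bicommutantB => //; apply: bicommutant_poly.
have [T0|T0] := leP (nrm T) 0; first exact: le_trans T0 e0.
have [p [mu [hp _ <- h0]]] := character_seminorm ST T0.
apply: le_trans (he _ (seminorm_spectrum hp h0)).
have Smu := bicommutantB bicommutantN (bicommutantA mu).
have [r hr] : exists r, q - (q.[mu])%:P = r * ('X - mu%:P).
  by apply/factor_theorem; rewrite /root !hornerE subrr.
have hq : horner_alg N q - (q.[mu])%:A = horner_alg N r * (N - mu%:A).
  have := congr1 (horner_alg N) hr.
  by rewrite rmorphM !rmorphB /= horner_algX !horner_algC.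
have hq0 : p (horner_alg N q - (q.[mu])%:A) <= 0.
  by rewrite hq; apply: le_trans (semi_M hp (bicommutant_poly r) Smu) _; rewrite h0 mulr0.
have hs0 : p (star N - (mu^*)%:A) = 0 by rewrite -star_scalar -starN -starD semi_star.
have -> : T = (star N - (mu^*)%:A) + ((mu^* - q.[mu])%:A +
    (-1) *: (horner_alg N q - (q.[mu])%:A)).
  by rewrite /T scaleN1r scalerBl opprB (addrA (_ - _) (q.[mu])%:A) subrK addrA subrK.
have Sq : S (horner_alg N q - (q.[mu])%:A).
  by apply: bicommutantB; [apply: bicommutant_poly | apply: bicommutantA].
have SA c := bicommutantA c.
have Sneg := bicommutantZ (-1) Sq.
apply: le_trans (semi_D hp _ _) _.
- by apply: bicommutantB.
- by apply: bicommutantD.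
rewrite hs0 add0r; apply: le_trans (semi_D hp _ _) _ => //.
rewrite semiA // -[leRHS]addr0 lerD2l.
by apply: le_trans (semi_Z hp _ Sq) _; rewrite mdN md1 mul1r.
Qed.

End Normal.

(** A seminorm attaining [nrm b] makes [b] a scalar [mu], real since [b] is self-adjoint, with
    modulus [nrm b]. The sign of [mu] is [s], so [t] and [s * mu] add up without cancellation. *)
Lemma selfadjoint_norm_attained b : star b = b -> 0 < nrm b ->
  exists s : R, s ^+ 2 = 1 /\ forall t : R, 0 <= t ->
    t + nrm b <= nrm (((t%:C)%C : C)%:A + ((s%:C)%C : C) *: b).
Proof.
move=> hb b0; have nb : normal_elt star b by rewrite /normal_elt hb.
have Sb := @bicommutantN b.
have [p [mu [hp hle hpb h0]]] := character_seminorm nb Sb b0.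
have Smu := bicommutantB Sb (@bicommutantA b mu).
have SA c := @bicommutantA b c.
have h0' : p (b - (mu^*)%:A) = 0.
  by rewrite -[in LHS]hb -star_scalar -starN -starD (semi_star hp).
have mur : mu^* = mu.
  apply/eqP; rewrite -subr_eq0 -md_eq0 eq_le md_ge0 andbT -(semiA hp).
  have -> : (mu^* - mu)%:A = (b - mu%:A) + (-1) *: (b - (mu^*)%:A) :> A.
    by rewrite scaleN1r opprB scalerBl [RHS]addrC addrA subrK.
  have Sm' := bicommutantB Sb (SA mu^*).
  apply: le_trans (semi_D hp Smu (bicommutantZ (-1) Sm')) _.
  by rewrite h0 add0r; apply: le_trans (semi_Z hp _ Sm') _; rewrite h0' mulr0.
have him : complex.Im mu = 0.
  by have := congr1 (@complex.Im R) mur; rewrite conjE /=; lra.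
have emu : mu = ((complex.Re mu)%:C)%C by apply: cplx_eq.
have hmu : `|complex.Re mu| = nrm b.
  rewrite -md_real -emu -hpb; apply/eqP; rewrite eq_le; apply/andP; split.
    rewrite -(semiA hp).
    have -> : mu%:A = b + (-1) *: (b - mu%:A) by rewrite scaleN1r opprB addrC subrK.
    apply: le_trans (semi_D hp Sb (bicommutantZ (-1) Smu)) _.
    by rewrite gerDl; apply: le_trans (semi_Z hp _ Smu) _; rewrite h0 mulr0.
  have -> : p b = p (mu%:A + (b - mu%:A)) by rewrite addrC subrK.
  by apply: le_trans (semi_D hp (SA mu) Smu) _; rewrite h0 addr0 (semiA hp).
exists (if 0 <= complex.Re mu then 1 else -1); split; first by case: ifP; rewrite ?sqrrN expr1n.
move=> t t0; set s : R := if _ then _ else _; set sc : C := ((s%:C)%C : C).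
have hs : t + nrm b = md (((t%:C)%C : C) + sc * mu).
  rewrite /sc emu -rmorphM -rmorphD /= md_real -hmu /s.
  case: ifP => h; first by rewrite mul1r !ger0_norm // addr_ge0.
  have {}h : complex.Re mu < 0 by rewrite ltNge h.
  by rewrite mulN1r ltr0_norm // ger0_norm // addr_ge0 //; lra.
rewrite hs -(semiA hp).
have Sx : bicommutant b (((t%:C)%C : C)%:A + sc *: b).
  by apply: bicommutantD => //; apply: bicommutantZ.
have -> : (((t%:C)%C : C) + sc * mu)%:A =
  (((t%:C)%C : C)%:A + sc *: b) + (- sc) *: (b - mu%:A).
  by rewrite scalerDl -addrA; congr (_ + _); rewrite scaleNr scalerBr scalerA opprB addrC subrK.
apply: le_trans (semi_D hp Sx (bicommutantZ (- sc) Smu)) _.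
apply: le_trans (_ : p (((t%:C)%C : C)%:A + sc *: b) <= _); last exact: hle.
by rewrite gerDl; apply: le_trans (semi_Z hp _ Smu) _; rewrite h0 mulr0.
Qed.

(* With x - x^* = 2 i b, the norm of (x + it)^* (x + it) = x^* x + 2 t b + t ^ 2 exceeds any
   M + t ^ 2 for t of suitable sign unless b = 0. *)
Lemma selfadjoint_criterion x (M : R) :
  (forall t : R, nrm (x + ('i * ((t%:C)%C : C))%:A) ^+ 2 <= M + t ^+ 2) -> star x = x.
Proof.
move=> hM; pose b := (- 'i / 2) *: (x - star x).
have hb : star b = b.
  rewrite /b starZ starD starN starK -[star x - x]opprB scalerN -scaleNr.
  by congr (_ *: _); rewrite rmorphM fmorphV rmorphN /= conjCi rmorph_nat; ring.
have hx : star x - x = (- (2 * 'i)) *: b.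
  rewrite /b scalerA; have -> : - (2 * 'i) * (- 'i / 2) = -1 :> C.
    by have := sqrCi R[i]; rewrite expr2 => hi2; field: hi2.
  by rewrite scaleN1r opprB.
clearbody b.
have [b0|b0] := eqVneq (nrm b) 0.
  by apply/eqP; rewrite -subr_eq0 hx (nrm_eq0 b0) scaler0.
have bp : 0 < nrm b by rewrite lt_neqAle eq_sym b0 nrm_ge0.
have [s [s2 hs]] := selfadjoint_norm_attained hb bp.
(* The sign [s] is built into the shift ['i * (s * t)]. The product becomes
   [star x * x + 2 t (t / 2 + s b)], whose norm is at least [t ^ 2 + 2 t nrm b - nrm x ^ 2]. *)
have key (t : R) : 0 < t -> 2 * t * nrm b <= M + nrm x ^+ 2.
  move=> t0; have t2 : 0 <= t / 2 by lra.
  pose tc : C := ((t%:C)%C : C); pose sc : C := ((s%:C)%C : C).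
  have mt : md tc = t by rewrite md_real gtr0_norm.
  have := hM (s * t); rewrite -nrm_sq rmorphM /= -/tc -/sc.
  set w := 'i * _.
  have sc2 : sc ^+ 2 = 1 by rewrite /sc -rmorphXn s2.
  have hi2 := sqrCi R[i]; rewrite expr2 in hi2.
  have hcc : w^* = - w.
    have conj_real (r : R) : (((r%:C)%C : C))^* = ((r%:C)%C : C) by rewrite conjE /= oppr0.
    by rewrite /w !rmorphM /= conjCi !conj_real mulNr.
  have hw1 : w * - (2 * 'i) = 2 * tc * sc by rewrite /w; ring: hi2.
  have hw2 : - w * w = tc ^+ 2.
    by rewrite -[RHS]mul1r -sc2 /w; ring: hi2.
  have -> : star (x + w%:A) * (x + w%:A) =
     star x * x + (2 * tc) *: (((((t / 2)%:C)%C : C))%:A + sc *: b).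
    rewrite starD star_scalar hcc mulrDl !mulrDr -!scalerAl -!scalerAr !mul1r !mulr1 -addrA; congr (_ + _).
    rewrite addrA scaleNr -scalerBr hx !scalerA hw1 hw2 addrC scalerDr !scalerA.
    congr (_ *: _ + _).
    by rewrite rmorphM fmorphV rmorph_nat /= -/tc; field.
  move=> h1; have h2 := hs _ t2; rewrite -/sc in h2.
  set v := (_%:A + sc *: b) in h1 h2.
  have h3 : 2 * t * nrm v <= nrm (star x * x + (2 * tc) *: v) + nrm x ^+ 2.
    have <- : nrm ((2 * tc) *: v) = 2 * t * nrm v by rewrite nrmZ mdM md_nat mt.
    rewrite -nrm_sq -(nrmN (star x * x)); apply: le_trans (nrmD _ _).
    by rewrite addrAC subrr add0r.
  have h4 : (s * t) ^+ 2 = t ^+ 2 by rewrite exprMn s2 mul1r.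
  rewrite h4 in h1.
  have h5 : 2 * t * (t / 2 + nrm b) <= 2 * t * nrm v by apply: ler_wpM2l => //; lra.
  by nra.
have M0 : 0 <= M + nrm x ^+ 2 by have := key 1 ltr01; lra.
have k0 : 0 < (M + nrm x ^+ 2 + 1) / nrm b by rewrite divr_gt0 //; lra.
exfalso; have := key _ k0; rewrite -mulrA divfK //; lra.
Qed.

End CstarAlgebra.

(** * From the polynomial isometry to normality *)

Theorem theorem3p2 (R : realType)
  (AA : algType (cplx R)) (starA : AA -> AA) (nrmA : AA -> R)
  (BB : algType (cplx R)) (starB : BB -> BB) (nrmB : BB -> R)
  (HA : is_unital_Cstar_algebra starA nrmA)
  (HB : is_unital_Cstar_algebra starB nrmB)
  (N : AA) (A : BB)
  (HN : normal_elt starA N)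
  (Hsp : Lavrentieff (spectrum N))
  (Hp : forall p : {poly cplx R}, nrmA (horner_alg N p) = nrmB (horner_alg A p)) :
  normal_elt starB A.
Proof.
have hconj := Lavrentieff_poly_approx_conj Hsp.
have appr (e : R) : 0 < e -> exists q : {poly cplx R}, nrmA (starA N - horner_alg N q) <= e.
  move=> e0; have [q hq] := hconj e e0; exists q.
  exact: (nrm_star_sub_poly HA HN (ltW e0) hq).
pose eps (n : nat) : R := n.+1%:R^-1.
have eps0 n : 0 < eps n by rewrite invr_gt0.
have [q hq] : exists q : nat -> {poly cplx R}, forall n, nrmA (starA N - horner_alg N (q n)) <= eps n.
  exists (fun n => projT1 (cid (appr _ (eps0 n)))) => n; exact: (projT2 (cid (appr _ (eps0 n)))).
have small (e : R) : 0 < e -> exists M : nat, forall n, (M <= n)%N -> eps n < e.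
  move=> e0; exists (Num.truncn (e^-1)) => n hn.
  rewrite /eps -[e]invrK ltf_pV2 ?posrE ?invr_gt0 //.
  by apply: lt_le_trans (truncnS_gt _) _; rewrite ler_nat.
have cauchy : forall e : R, 0 < e -> exists M : nat, forall m n : nat, (M <= m)%N -> (M <= n)%N ->
    nrmB (horner_alg A (q m) - horner_alg A (q n)) < e.
  move=> e e0; have e2 : 0 < e / 2 by lra.
  have [M hM] := small _ e2; exists M => m n hm hn.
  rewrite -rmorphB -Hp rmorphB /=.
  apply: le_lt_trans (nrm_triangle HA (starA N) _ _) _.
  rewrite -(nrmN HA) opprB.
  have := hq m; have := hq n; have := hM _ hm; have := hM _ hn; lra.
have [L hL] : exists l : BB, forall e : R, 0 < e -> exists M : nat, forall n : nat, (M <= n)%N ->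
    nrmB (horner_alg A (q n) - l) < e by case: HB => _ h _; apply: h.
(* The isometry [p(N) |-> p(A)] extends to [c N + d N^* + z |-> c A + d L + z]. *)
have iso (c d z : cplx R) : nrmB (c *: A + d *: L + z%:A) <= nrmA (c *: N + d *: starA N + z%:A).
  apply/ler_addgt0Pr => e e0.
  have md0' := md_ge0 d.
  have e1 : 0 < e / (2 * (md d + 1)) by rewrite divr_gt0 // mulr_gt0 //; lra.
  have [M1 h1] := small _ e1; have [M2 h2] := hL _ e1.
  pose n := maxn M1 M2.
  have {}h1 := h1 n (leq_maxl _ _); have {}h2 := h2 n (leq_maxr _ _).
  pose p : {poly cplx R} := c%:P * 'X + d%:P * q n + z%:P.
  have ev (D : algType (cplx R)) (x : D) : horner_alg x p = c *: x + d *: horner_alg x (q n) + z%:A.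
    by rewrite /p !rmorphD !rmorphM /= horner_algX !horner_algC !mulr_algl.
  have comb (D : algType (cplx R)) (x u v : D) :
      c *: x + d *: v + z%:A = c *: x + d *: u + z%:A + d *: (v - u).
    by rewrite scalerBr (addrAC _ (d *: u)) -[RHS]addrA [d *: u + _]addrC subrK addrAC.
  have hB : nrmB (c *: A + d *: L + z%:A) <= nrmB (horner_alg A p) + md d * nrmB (horner_alg A (q n) - L).
    have -> : c *: A + d *: L + z%:A = horner_alg A p + (- d) *: (horner_alg A (q n) - L).
      by rewrite ev scaleNr -scalerN opprB -comb.
    by apply: le_trans (nrmD HB _ _) _; rewrite (nrmZ HB) mdN.
  have hA : nrmA (horner_alg N p) <= nrmA (c *: N + d *: starA N + z%:A) + md d * nrmA (starA N - horner_alg N (q n)).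
    have -> : horner_alg N p = (c *: N + d *: starA N + z%:A) + (- d) *: (starA N - horner_alg N (q n)).
      by rewrite ev scaleNr -scalerN opprB -comb.
    by apply: le_trans (nrmD HA _ _) _; rewrite (nrmZ HA) mdN.
  have h3 := hq n.
  have h4 : e / (2 * (md d + 1)) * (2 * (md d + 1)) = e by rewrite divfK //; lra.
  have a1 : md d * nrmB (horner_alg A (q n) - L) <= md d * (e / (2 * (md d + 1))) by apply: ler_wpM2l => //; lra.
  have a2 : md d * nrmA (starA N - horner_alg N (q n)) <= md d * (e / (2 * (md d + 1))) by apply: ler_wpM2l => //; lra.
  rewrite Hp in hA; clear -hA hB a1 a2 h4 e1; lra.
have selfadj (c d : cplx R) : starA (c *: N + d *: starA N) = c *: N + d *: starA N ->
    starB (c *: A + d *: L) = c *: A + d *: L.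
  move=> h; apply: (selfadjoint_criterion HB (M := nrmA (c *: N + d *: starA N) ^+ 2)) => t.
  have hle := iso c d ('i * ((t%:C)%C : cplx R)).
  apply: le_trans (_ : nrmA (c *: N + d *: starA N + ('i * ((t%:C)%C : cplx R))%:A) ^+ 2 <= _).
    by apply: lerXn2r; rewrite ?nnegrE ?(nrm_ge0 HA) ?(nrm_ge0 HB).
  move: h; set x := _ + _ => h; clearbody x.
  set w : cplx R := 'i * _.
  have hw : w^* = - w by rewrite /w rmorphM /= conjCi (conjE ((t%:C)%C : cplx R)) /= oppr0 mulNr.
  have hw2 : - w * w = (((t ^+ 2)%:C)%C : cplx R).
    have := sqrCi R[i]; rewrite expr2 => hi2.
    by rewrite rmorphXn /= /w; ring: hi2.
  rewrite -(nrm_sq HA) (starD HA) (star_scalar HA) h hw.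
  have -> : (x + (- w)%:A) * (x + w%:A) = x * x + (((t ^+ 2)%:C)%C : cplx R)%:A.
    rewrite -hw2 mulrDl !mulrDr -!scalerAl -!scalerAr !mul1r !mulr1 scalerA -addrA; congr (_ + _).
    by rewrite addrA scaleNr subrr add0r.
  apply: le_trans (nrmD HA _ _) _; apply: lerD.
    by rewrite expr2; apply: (nrmM HA).
  by rewrite (nrm_scalar HA) md_real ger0_norm ?sqr_ge0.
(* Applied to the self-adjoint elements [N + star N] and ['i (N - star N)]; subtracting the two
   resulting identities gives [2 star A = 2 L]. *)
have h1 : starB A + starB L = A + L.
  have := selfadj 1 1; rewrite !scale1r (starD HA) (starK HA) addrC => /(_ erefl).
  by rewrite (starD HB).
have h2 : starB L - starB A = A - L.
  have := selfadj 'i (- 'i); rewrite !(starD HA) !(starZ HA) (starK HA) rmorphN /= conjCi opprK addrC => /(_ erefl).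
  rewrite (starD HB) !(starZ HB) rmorphN /= conjCi opprK !scaleNr -scalerBr addrC -scalerBr.
  by move=> /(scalerI _); apply; rewrite neq0Ci.
have hAL : starB A = L.
  have h3 : (2 : cplx R) *: starB A = 2 *: L.
    have dbl (u v : BB) : u + v - (v - u) = u + u by rewrite opprB [u - v]addrC addrA addrK.
    by rewrite !scaler_nat !mulr2n -(dbl _ (starB L)) h1 h2 [A + L]addrC dbl.
  by apply: (scalerI _ h3); rewrite pnatr_eq0.
rewrite /normal_elt hAL; apply/eqP; rewrite -subr_eq0; apply/eqP; apply: (nrm_eq0 HB).
clear h1 h2 hAL.
apply/eqP; rewrite eq_le (nrm_ge0 HB) andbT; apply/ler_addgt0Pr => e e0; rewrite add0r.
have a0 := nrm_ge0 HB A.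
have e1 : 0 < e / (2 * (nrmB A + 1)) by rewrite divr_gt0 // mulr_gt0 //; lra.
have [n0 hn] := hL _ e1; have {}hn := hn n0 (leqnn _).
set B := horner_alg A (q n0) in hn.
have hAB : A * B = B * A.
  transitivity (horner_alg A ('X * q n0)); first by rewrite rmorphM /= horner_algX.
  by rewrite mulrC rmorphM /= horner_algX.
(* One polynomial [B] in [A] close to [L] suffices: it commutes with [A], so the commutator depends
   only on [B - L]. *)
have -> : L * A - A * L = A * (B - L) - (B - L) * A.
  by rewrite mulrBr mulrBl hAB opprB [RHS]addrC addrA subrK.
clear hAB.
apply: le_trans (nrmD HB _ _) _; rewrite (nrmN HB).
have k1 := nrmM HB A (B - L); have k2 := nrmM HB (B - L) A.
have k3 : nrmB A * nrmB (B - L) <= nrmB A * (e / (2 * (nrmB A + 1))) by apply: ler_wpM2l => //; apply: ltW.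
have h4 : e / (2 * (nrmB A + 1)) * (2 * (nrmB A + 1)) = e by rewrite divfK //; lra.
by rewrite mulrC in k2; clear -k1 k2 k3 h4 e1; lra.
Qed.
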